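(* Let $G$ be a finite group such that the order of $G$ is not divisible by $9$ and let $q$ be a prime. Then $\mathrm V(\mathbb ZG)$ contains a unit of order $3q$ if and only if $G$ contains an element of order $3q$.
   Context: $\mathrm V(\mathbb ZG)$ denotes the group of normalized units of the integral group ring $\mathbb ZG$, i.e. the units whose sum of coefficients is $1$. *)

(* Defs.v *)
From HB Require Import structures.
From mathcomp Require Import all_boot all_fingroup all_algebra.
From mathcomp Require Import boolp.

Set Implicit Arguments.
Unset Strict Implicit.
Unset Printing Implicit Defensive.

Import GRing.Theory.
Local Open Scope ring_scope.

(* The group ring R[gT]: x stands for the formal sum of the (x g) g, g : gT.
   The alias keeps its convolution product apart from the pointwise
   operations that {ffun gT -> R} inherits from R. *)
Definition groupRing (R : nzRingType) (gT : finGroupType) : Type :=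
  {ffun gT -> R}.

Section GroupRing.

Variables (R : nzRingType) (gT : finGroupType).

HB.instance Definition _ :=
  GRing.Zmodule.copy (groupRing R gT) {ffun gT -> R}.

Implicit Types (x y z : groupRing R gT) (g h : gT).

Definition gr_coef x : gT -> R := fun_of_fin x.

Definition gr_one : groupRing R gT := [ffun g => (g == 1%g)%:R].

Definition gr_mul x y : groupRing R gT :=
  [ffun g => \sum_(h : gT) gr_coef x h * gr_coef y (h^-1 * g)%g].

Definition augmentation x : R := \sum_(g : gT) gr_coef x g.

Lemma gr_coefP x y : gr_coef x =1 gr_coef y -> x = y.
Proof. by move=> exy; apply/ffunP. Qed.

Lemma gr_coefD x y g : gr_coef (x + y) g = gr_coef x g + gr_coef y g.
Proof. by rewrite /gr_coef ffunE. Qed.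

Lemma gr_coef1 g : gr_coef gr_one g = (g == 1%g)%:R.
Proof. by rewrite /gr_coef ffunE. Qed.

Lemma gr_coefM x y g :
  gr_coef (gr_mul x y) g = \sum_(h : gT) gr_coef x h * gr_coef y (h^-1 * g)%g.
Proof. by rewrite {1}/gr_coef ffunE. Qed.

Fact gr_mulA : associative gr_mul.
Proof.
move=> x y z; apply: gr_coefP => g; rewrite !gr_coefM.
under eq_bigr => h _ do rewrite gr_coefM mulr_sumr.
under [RHS]eq_bigr => h _ do rewrite gr_coefM mulr_suml.
rewrite [RHS]exchange_big; apply: eq_bigr => h _ /=.
rewrite [RHS](reindex_inj (mulgI h)) /=; apply: eq_bigr => k _.
by rewrite mulKg mulrA invMg mulgA.
Qed.

Fact gr_mul1 : left_id gr_one gr_mul.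
Proof.
move=> x; apply: gr_coefP => g; rewrite gr_coefM (bigD1 1%g) //=.
rewrite gr_coef1 eqxx mul1r invg1 mul1g big1 ?addr0 // => h /negPf h1.
by rewrite gr_coef1 h1 mul0r.
Qed.

Fact gr_mulr1 : right_id gr_one gr_mul.
Proof.
move=> x; apply: gr_coefP => g; rewrite gr_coefM (bigD1 g) //=.
rewrite gr_coef1 mulVg eqxx mulr1 big1 ?addr0 // => h hg.
by rewrite gr_coef1 -eq_mulVg1 (negPf hg) mulr0.
Qed.

Fact gr_mulDl : left_distributive gr_mul +%R.
Proof.
move=> x y z; apply: gr_coefP => g; rewrite gr_coefD !gr_coefM -big_split.
by apply: eq_bigr => h _; rewrite gr_coefD mulrDl.
Qed.

Fact gr_mulDr : right_distributive gr_mul +%R.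
Proof.
move=> x y z; apply: gr_coefP => g; rewrite gr_coefD !gr_coefM -big_split.
by apply: eq_bigr => h _; rewrite gr_coefD mulrDr.
Qed.

Fact gr_one_neq0 : gr_one != 0.
Proof.
apply/eqP => /(congr1 (fun x => gr_coef x 1%g)) /eqP.
by rewrite gr_coef1 eqxx /gr_coef ffunE oner_eq0.
Qed.

HB.instance Definition _ := GRing.Zmodule_isNzRing.Build (groupRing R gT)
  gr_mulA gr_mul1 gr_mulr1 gr_mulDl gr_mulDr gr_one_neq0.

(* Units are the two-sided invertible elements; inverses are chosen
   classically, and the inverse of a non-unit is itself by convention. *)
Definition gr_unit : pred (groupRing R gT) :=
  [pred x | `[< exists y : groupRing R gT, y * x = 1 /\ x * y = 1 >]].

Definition gr_inv x : groupRing R gT :=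
  if pselect (exists y : groupRing R gT, y * x = 1 /\ x * y = 1) is left ex
  then projT1 (cid ex) else x.

Fact gr_mulVr : {in gr_unit, left_inverse 1 gr_inv *%R}.
Proof.
move=> x /asboolP ux; rewrite /gr_inv; case: pselect => // ex.
by case: (projT2 (cid ex)).
Qed.

Fact gr_mulrV : {in gr_unit, right_inverse 1 gr_inv *%R}.
Proof.
move=> x /asboolP ux; rewrite /gr_inv; case: pselect => // ex.
by case: (projT2 (cid ex)).
Qed.

Fact gr_unitP x y : y * x = 1 /\ x * y = 1 -> x \in gr_unit.
Proof. by move=> yx; apply/asboolP; exists y. Qed.

Fact gr_inv_out : {in [predC gr_unit], gr_inv =1 id}.
Proof.
by move=> x /asboolPn nux; rewrite /gr_inv; case: pselect.
Qed.

HB.instance Definition _ := GRing.NzRing_hasMulInverse.Build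
  (groupRing R gT) gr_mulVr gr_mulrV gr_unitP gr_inv_out.

Definition normalized_units : pred (groupRing R gT) :=
  [pred u | (u \is a GRing.unit) && (augmentation u == 1)].

End GroupRing.

Arguments normalized_units : clear implicits.

(* Main.v *)
(* Let u be a normalized unit of order 3q with q <> 3, put v = u^q and w = u^3,
   and suppose that G has no element of order 3q. Let s(x) be the sum of the
   coefficients of x at the elements of order divisible by 3. Rotating words
   gives congruences between the partial augmentations of x and of x^(p^m);
   together with the positivity of traces of idempotents they yield s(v) = 1,
   s(w^i) = 0, s(u^j) = s(u) for j coprime to 3q, and 3 | s(u).
   On the other hand let P be a Sylow 3-subgroup, of order 3, N = P : B its
   normalizer and eps the sign of the action of N on P. Then
   2 Ind_N 1 + Ind_N eps - Ind_B 1 equals 3 on elements of order divisible by 3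
   and 0 elsewhere. Modulo 3 the module induced from B is filtered by those
   induced from 1_N, eps and 1_N. Distinct Sylow 3-subgroups meet trivially, so
   the first is trivial plus projective, and the filtration splits on the image
   of E = q - (1 + w + ... + w^(q-1)), which kills trivial modules. The
   multiplicity of a primitive cube root of unity as an eigenvalue of v on a
   lattice can be read off modulo 3 from the ranks of v - 1 and (v - 1)^2.
   Hence s(E (2 - v - v^2)) = 0, that is, s(u) = 1: a contradiction.
   For q = 3, the congruence modulo 3 between the partial augmentations of u and
   of u^3 is violated. *)

Require Import Defs.
From mathcomp Require Import all_boot all_fingroup all_algebra.
From mathcomp Require Import cyclic pgroup sylow hall.
From mathcomp Require Import ring zify.

Set Implicit Arguments.
Unset Strict Implicit.
Unset Printing Implicit Defensive.

Import GRing.Theory Num.Theory.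
Local Open Scope ring_scope.

(** * Group rings *)

Section GroupRingBasics.
Variables (R : comNzRingType) (gT : finGroupType).
Implicit Types (x y z : groupRing R gT) (f : gT -> R) (g h : gT).

Definition gr_delta g : groupRing R gT := [ffun h => (h == g)%:R].

(* For a class function f this is the sum of the values of f weighted by the
   partial augmentations of x. *)
Definition lin f x : R := \sum_g gr_coef x g * f g.

Lemma gr_coef0 g : gr_coef (0 : groupRing R gT) g = 0.
Proof. by rewrite /gr_coef ffunE. Qed.

Lemma gr_coefN x g : gr_coef (- x) g = - gr_coef x g.
Proof. by rewrite /gr_coef ffunE. Qed.

Lemma gr_coef_mul x y g :
  gr_coef (x * y) g = \sum_h gr_coef x h * gr_coef y (h^-1 * g)%g.
Proof. exact: gr_coefM. Qed.

Lemma gr_coef_mul_r x y g :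
  gr_coef (x * y) g = \sum_h gr_coef x (g * h^-1)%g * gr_coef y h.
Proof.
rewrite gr_coef_mul (reindex_inj invg_inj) (reindex_inj (mulIg g^-1%g)) /=.
by apply: eq_bigr => h _; rewrite !invMg !invgK mulgKV.
Qed.

Lemma gr_coef_one g : gr_coef (1 : groupRing R gT) g = (g == 1%g)%:R.
Proof. exact: gr_coef1. Qed.

Lemma gr_coef_sum I (r : seq I) (P : pred I) (F : I -> groupRing R gT) g :
  gr_coef (\sum_(i <- r | P i) F i) g = \sum_(i <- r | P i) gr_coef (F i) g.
Proof.
by elim/big_rec2: _ => [|i a b _ <-]; rewrite ?gr_coef0 ?gr_coefD.
Qed.

Lemma gr_coefMn x n g : gr_coef (x *+ n) g = gr_coef x g *+ n.
Proof.
by elim: n => [|n IH]; rewrite ?mulr0n ?gr_coef0 // !mulrS gr_coefD IH.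
Qed.

Lemma gr_coef_delta g h : gr_coef (gr_delta g) h = (h == g)%:R.
Proof. by rewrite /gr_coef ffunE. Qed.

Lemma gr_delta1 : gr_delta 1%g = 1.
Proof. by apply: gr_coefP => g; rewrite gr_coef_one. Qed.

Lemma gr_coef_deltaMl g x h : gr_coef (gr_delta g * x) h = gr_coef x (g^-1 * h)%g.
Proof.
rewrite gr_coef_mul (bigD1 g) //= gr_coef_delta eqxx mul1r big1 ?addr0 // => k kg.
by rewrite gr_coef_delta (negPf kg) mul0r.
Qed.

Lemma gr_coef_deltaMr g x h : gr_coef (x * gr_delta g) h = gr_coef x (h * g^-1)%g.
Proof.
rewrite gr_coef_mul_r (bigD1 g) //= gr_coef_delta eqxx mulr1 big1 ?addr0 // => k kg.
by rewrite gr_coef_delta (negPf kg) mulr0.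
Qed.

Lemma gr_deltaM g h : gr_delta g * gr_delta h = gr_delta (g * h)%g.
Proof.
apply: gr_coefP => k; rewrite gr_coef_deltaMl !gr_coef_delta.
by rewrite -(inj_eq (mulgI g)) mulKVg.
Qed.

Lemma linD f x y : lin f (x + y) = lin f x + lin f y.
Proof.
by rewrite /lin -big_split; apply: eq_bigr => g _; rewrite gr_coefD mulrDl.
Qed.

Lemma lin0 f : lin f 0 = 0.
Proof. by rewrite /lin big1 // => g _; rewrite gr_coef0 mul0r. Qed.

Lemma linN f x : lin f (- x) = - lin f x.
Proof.
by apply: (addrI (lin f x)); rewrite -linD !subrr lin0.
Qed.

Lemma linB f x y : lin f (x - y) = lin f x - lin f y.
Proof. by rewrite linD linN. Qed.

Lemma linMn f x n : lin f (x *+ n) = lin f x *+ n.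
Proof. by elim: n => [|n IH]; rewrite ?mulr0n ?lin0 // !mulrS linD IH. Qed.

Lemma lin_sum f I (r : seq I) (P : pred I) (F : I -> groupRing R gT) :
  lin f (\sum_(i <- r | P i) F i) = \sum_(i <- r | P i) lin f (F i).
Proof. by elim/big_rec2: _ => [|i a b _ <-]; rewrite ?lin0 ?linD. Qed.

Lemma linM f x y :
  lin f (x * y) = \sum_g gr_coef x g * lin (fun h => f (g * h)%g) y.
Proof.
rewrite /lin; under eq_bigr => g _ do rewrite gr_coef_mul mulr_suml.
rewrite exchange_big; apply: eq_bigr => g _ /=; rewrite mulr_sumr.
rewrite (reindex_inj (mulgI g)); apply: eq_bigr => h _ /=.
by rewrite mulKg mulrA.
Qed.

Lemma lin_one f : lin f 1 = f 1%g.
Proof.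
rewrite /lin (bigD1 1%g) //= gr_coef_one eqxx mul1r big1 ?addr0 // => g g1.
by rewrite gr_coef_one (negPf g1) mul0r.
Qed.

Lemma lin_delta f g : lin f (gr_delta g) = f g.
Proof.
rewrite /lin (bigD1 g) //= gr_coef_delta eqxx mul1r big1 ?addr0 // => h hg.
by rewrite gr_coef_delta (negPf hg) mul0r.
Qed.

Lemma augmentationE x : augmentation x = lin (fun=> 1) x.
Proof. by apply: eq_bigr => g _; rewrite mulr1. Qed.

Lemma augmentationM x y : augmentation (x * y) = augmentation x * augmentation y.
Proof.
rewrite !augmentationE linM /lin mulr_suml.
by apply: eq_bigr => g _; rewrite mulr1.
Qed.

Lemma augmentation1 : augmentation (1 : groupRing R gT) = 1.
Proof. by rewrite augmentationE lin_one. Qed.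

Lemma augmentationX x n : augmentation (x ^+ n) = augmentation x ^+ n.
Proof.
by elim: n => [|n IH]; rewrite ?expr0 ?augmentation1 // !exprS augmentationM IH.
Qed.

End GroupRingBasics.

Arguments gr_delta {R gT}.

(** * Congruences between partial augmentations *)

Section Words.
Variable gT : finGroupType.
Implicit Types (x : groupRing int gT) (f : gT -> int) (w : seq gT).

Definition word_coef x w : int := \prod_(g <- w) gr_coef x g.
Definition word_val w : gT := (\prod_(g <- w) g)%g.

(** Multiplying out the power without collecting terms leaves one term for each word; rotations can
    then act on the terms. *)
Lemma linX n x f : lin f (x ^+ n) =
  \sum_(w : n.-tuple gT) word_coef x w * f (word_val w).
Proof.
elim: n f => [|n IH] f.
  rewrite expr0 lin_one (bigD1 [tuple]) //= big1 => [|t]; last by rewrite tuple0.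
  by rewrite addr0 /word_coef /word_val !big_nil mul1r.
rewrite exprS linM.
under eq_bigr => g _ do rewrite IH mulr_sumr.
rewrite pair_big /= [RHS](reindex (fun p : gT * n.-tuple gT => cons_tuple p.1 p.2)).
  by apply: eq_bigr => -[g t] _ /=; rewrite /word_coef /word_val !big_cons mulrA.
exists (fun t : n.+1.-tuple gT => (thead t, behead_tuple t)) => [[g t] _|t _] /=.
  by congr (_, _); apply: val_inj.
by rewrite [RHS]tuple_eta; apply: val_inj.
Qed.

Lemma word_coef_rot k x w : word_coef x (rot k w) = word_coef x w.
Proof. by apply: perm_big; rewrite perm_rot. Qed.

Definition class_fun f := forall g h, f (g * h)%g = f (h * g)%g.

Lemma word_val_rot k f w : class_fun f -> f (word_val (rot k w)) = f (word_val w).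
Proof.
move=> cf; rewrite /word_val /rot big_cat cf -big_cat.
by rewrite cat_take_drop.
Qed.

(** If [w = t ++ d] is fixed, then [t ++ d = d ++ t], so [d] begins with [t] and is again fixed by
    [rot k]; induction on [p] applies to [d]. *)
Lemma rot_fixed_flatten p k w : size w = (p * k)%N -> rot k w = w ->
  w = flatten (nseq p (take k w)).
Proof.
elim: p w => [|[|p] IH] w sw; first by move/size0nil: sw => ->.
  by move=> _ /=; rewrite cats0 take_oversize // sw mul1n.
set t := take k w; set d := drop k w; rewrite /rot -/t -/d => dt.
have Ew : w = t ++ d by rewrite cat_take_drop.
have st : size t = k by rewrite size_take sw; case: ltngtP; lia.
have sd : size d = (p.+1 * k)%N by rewrite size_drop sw mulSn addKn.
have Ed : take k d = t.
  by rewrite -(takel_cat t) ?dt // sd mulSn leq_addr.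
have Ed' : t ++ drop k d = d by rewrite -Ed cat_take_drop.
have rd : rot k d = d.
  rewrite /rot Ed; apply/eqP; rewrite -[_ == _]andTb -(eqxx t).
  by rewrite -eqseq_cat // catA Ed' dt -Ew.
rewrite {1}Ew; have := IH d sd rd; rewrite Ed => {1}->.
by [].
Qed.

(* The words which are not p-th powers of shorter words have p ^ m.+1 distinct
   rotations. *)
Lemma sum_rotation_invariant p m (Phi : seq gT -> int) : prime p ->
    (forall k w, Phi (rot k w) = Phi w) ->
  (\sum_(w : (p ^ m.+1).-tuple gT) Phi w =
   \sum_(t : (p ^ m).-tuple gT) Phi (flatten (nseq p (tval t))) %[mod (p ^ m.+1)%N])%Z.
Proof.
move=> p_pr rotPhi; set N := (p ^ m.+1)%N; set k := (p ^ m)%N.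
have NE : N = (p * k)%N by rewrite /N expnS.
have rt_inj : injective (fun w : N.-tuple gT => rot_tuple 1 w).
  by move=> a b /(congr1 val) /= /rot_inj /val_inj.
pose s := perm rt_inj.
have sX i (w : N.-tuple gT) : (i <= N)%N -> tval ((s ^+ i)%g w) = rot i w.
  elim: i => [|i IH] iN; first by rewrite expg0 perm1 rot0.
  by rewrite expgSr permM permE /= IH ?(ltnW iN) // -rotS // size_tuple.
have sN : (s ^+ N = 1)%g.
  apply/permP => w; apply: val_inj; rewrite /= sX // perm1 rot_oversize //.
  by rewrite size_tuple.
have kN : (k <= N)%N by rewrite leq_exp2l ?prime_gt1.
(* The orbit length divides [p ^ m.+1]; if it were smaller, it would divide [k], and rotation by [k]
   would fix [w]. *)
have s_orbit (w : N.-tuple gT) : rot k w != w -> #|porbit s w| = N.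
  have dN : (#|porbit s w| %| N)%N.
    apply: dvdn_trans (_ : #[s]%g %| N)%N; last by rewrite order_dvdn sN.
    by rewrite porbit.unlock; apply: (dvdn_orbit 'P%act).
  move=> wk; apply/eqP; rewrite eqn_dvd dN /=.
  have /(dvdn_pfactor _ _ p_pr)[j jm dj] := dN.
  case: (leqP j m) => jm'; last by rewrite dj dvdn_exp2l.
  have ek : (s ^+ k)%g w = w.
    rewrite permX; have /dvdnP[a ->] : (#|porbit s w| %| k)%N.
      by rewrite dj dvdn_exp2l.
    by elim: a => [//|a IH]; rewrite mulSn iterD IH iter_porbit.
  by case/eqP: wk; rewrite -sX // ek.
rewrite (bigID (fun w : N.-tuple gT => rot k w == w)) /=.
(* The words fixed by rotation by [k] are the [p]-th powers of the words of length [k]. *)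
have -> : \sum_(w : N.-tuple gT | rot k w == w) Phi w =
    \sum_(t : k.-tuple gT) Phi (flatten (nseq p (tval t))).
  have st (t : k.-tuple gT) : size (flatten (nseq p (tval t))) == N.
    by rewrite size_flatten /shape map_nseq sumn_nseq size_tuple mulnC NE.
  have sw (w : N.-tuple gT) : size (take k w) == k.
    by rewrite size_takel // size_tuple.
  rewrite (reindex_onto (fun t : k.-tuple gT => Tuple (st t))
    (fun w : N.-tuple gT => Tuple (sw w))) /=.
    apply: eq_bigl => t.
    have take_t : take k (flatten (nseq p (tval t))) = t.
      rewrite -(prednK (prime_gt0 p_pr)) /= take_size_cat //.
      by rewrite size_tuple.
    rewrite -val_eqE /= take_t eqxx andbT.
    suff -> : rot k (flatten (nseq p (tval t))) = flatten (nseq p (tval t)).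
      by rewrite eqxx.
    rewrite -(prednK (prime_gt0 p_pr)) /= -{1}(size_tuple t) rot_size_cat.
    by elim: (p.-1) => [|a IH] /=; [rewrite cats0 | rewrite -catA IH].
  move=> w /eqP rw; apply: val_inj => /=.
  by rewrite -rot_fixed_flatten // size_tuple NE.
suff: (N %| \sum_(w : N.-tuple gT | rot k w != w) Phi w)%Z.
  by move=> Nd; apply/eqP; rewrite eqz_mod_dvd addrAC subrr add0r.
rewrite (partition_big_imset (porbit s)) /=; apply: rpred_sum => O.
case/imsetP => w0 w0k ->; rewrite unfold_in in w0k.
rewrite (eq_bigl [in porbit s w0]); last first.
  move=> w; rewrite eq_porbit_mem andbC; apply: andb_idr => /porbitPmin [i iN ->].
  have iN' : (i <= N)%N.
    apply: leq_trans (ltnW iN) _.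
    by rewrite dvdn_leq ?expn_gt0 ?prime_gt0 // order_dvdn sN.
  rewrite unfold_in sX //; apply: contra w0k => /eqP e; apply/eqP.
  by apply: (@rot_inj i); rewrite rot_rot.
rewrite (eq_bigr (fun=> Phi w0)); last first.
  move=> w /porbitPmin[i iN ->]; rewrite sX ?rotPhi // (leq_trans (ltnW iN)) //.
  by rewrite dvdn_leq ?expn_gt0 ?prime_gt0 // order_dvdn sN.
by rewrite sumr_const s_orbit // -mulr_natr natz dvdz_mull.
Qed.

(** Coefficients are raised to the power while group elements stay: a word gets for [coef_pow n x]
    the weight that its [n]-fold repetition has for [x]. *)
Definition coef_pow n x : groupRing int gT := [ffun g => gr_coef x g ^+ n].

Lemma word_coef_flatten n x w :
  word_coef x (flatten (nseq n w)) = word_coef x w ^+ n.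
Proof.
rewrite /word_coef; elim: n => [|n IH] /=; first by rewrite big_nil.
by rewrite big_cat exprS IH.
Qed.

Lemma word_val_flatten n w :
  word_val (flatten (nseq n w)) = (word_val w ^+ n)%g.
Proof.
rewrite /word_val; elim: n => [|n IH] /=; first by rewrite big_nil.
by rewrite big_cat expgS IH.
Qed.

(** Only the terms of [p]-th powers of words survive modulo [p ^ m.+1]; repeating a word [p] times
    raises both its weight and its value to the power [p]. *)
Lemma lin_pow_congr p m f x : prime p -> class_fun f ->
  (lin f (x ^+ (p ^ m.+1)) =
   lin (fun g => f (g ^+ p)%g) (coef_pow p x ^+ (p ^ m)) %[mod (p ^ m.+1)%N])%Z.
Proof.
move=> p_pr cf; rewrite !linX.
rewrite (sum_rotation_invariant _ (Phi := fun w => word_coef x w * f (word_val w))) //.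
  congr (_ %% _)%Z; apply: eq_bigr => t _.
  rewrite word_coef_flatten word_val_flatten; congr (_ * _).
  by rewrite /word_coef -prodrXl; apply: eq_bigr => g _; rewrite [RHS]/gr_coef ffunE.
by move=> k w; rewrite word_coef_rot word_val_rot.
Qed.

Lemma class_fun_pow n f : class_fun f -> class_fun (fun g => f (g ^+ n)%g).
Proof.
move=> cf g h; have -> : (g * h = (h * g) ^ h)%g by rewrite conjgE -mulgA mulKg.
by rewrite -conjXg conjgE cf mulgK.
Qed.

(** Each use of [lin_pow_congr] composes [f] with the [p]-th power map and lowers the exponent by
    one. After [j] uses the function is 0, and the last modulus is the weakest. *)
Lemma lin_pow_vanish p j m f x : prime p -> class_fun f ->
    (forall g, f (g ^+ (p ^ j))%g = 0) ->
  ((p ^ (m.+1 - j))%N %| lin f (x ^+ (p ^ m)))%Z.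
Proof.
move=> p_pr; elim: j m f x => [|j IH] m f x cf f0.
  rewrite /lin big1 ?dvdz0 // => g _.
  by have := f0 g; rewrite expn0 expg1 => ->; rewrite mulr0.
case: m => [|m]; first by rewrite subSS sub0n expn0 dvd1z.
rewrite subSS.
have dN : ((p ^ (m.+1 - j))%N %| (p ^ m.+1)%N%:Z)%Z.
  by rewrite dvdzE !absz_nat dvdn_exp2l // leq_subr.
have := lin_pow_congr m x p_pr cf.
move/eqP; rewrite eqz_mod_dvd => /(dvdz_trans dN) h.
rewrite -[X in (_ %| X)%Z](subrK (lin (fun g => f (g ^+ p)%g)
   (coef_pow p x ^+ (p ^ m)))).
apply: rpredD => //; apply: IH; first exact: class_fun_pow.
by move=> g; rewrite -expgM mulnC -expnS.
Qed.
End Words.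

(** * Partial augmentations of torsion elements *)

Section Torsion.
Variable gT : finGroupType.
Implicit Types (x u : groupRing int gT) (f : gT -> int).

Lemma expr_mod_order n u i : u ^+ n = 1 -> u ^+ (i %% n) = u ^+ i.
Proof.
by move=> un; rewrite [in RHS](divn_eq i n) exprD mulnC exprM un expr1n mul1r.
Qed.

(* u = u ^+ (p ^ m) for arbitrarily large m, so lin f u is divisible by
   arbitrarily large powers of p. *)
Lemma lin_singular_eq0 p n f u : prime p -> coprime p n -> u ^+ n = 1 ->
    class_fun f -> (forall g, f g != 0 -> (p %| #[g]%g)%N) ->
  lin f u = 0.
Proof.
move=> p_pr cpn un cf fp; apply/eqP/negP => /negP fu0.
pose j := logn p #|gT|.
(* Since [j] is the exponent of [p] in the group order, [g ^+ (p ^ j)] has order prime to [p]. *)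
have f0 g : f (g ^+ (p ^ j))%g = 0.
  apply/eqP/negP => /negP /fp pd.
  have := orderXpfactor (erefl _) p_pr pd => og.
  have : (p ^ j.+1 %| #|[set: gT]|)%N.
    apply: dvdn_trans (order_dvdG (in_setT g)).
    by rewrite og expnSr dvdn_mul.
  by rewrite pfactor_dvdn ?cardG_gt0 // cardsT ltnn.
(* Euler's theorem gives [u ^+ (p ^ (e * K)) = u], and [K] is so large that the power of [p]
   dividing [lin f u] exceeds its absolute value. *)
pose e := totient n; pose K := (`|lin f u| + j)%N.
have n0 : (0 < n)%N.
  by case: n cpn {un e} => // /eqP; rewrite gcdn0 => p1; rewrite p1 in p_pr.
have ue : u ^+ (p ^ (e * K)) = u.
  rewrite -(expr_mod_order _ un) expnM -modnXm Euler_exp_totient // modnXm exp1n.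
  by rewrite (expr_mod_order _ un).
have := lin_pow_vanish (e * K) u p_pr cf f0; rewrite ue => /dvdn_leq.
rewrite absz_gt0 fu0 absz_nat => /(_ isT).
rewrite leqNgt => /negP []; apply: leq_ltn_trans (ltn_expl _ (prime_gt1 p_pr)).
have e0 : (0 < e)%N by rewrite totient_gt0.
rewrite -(leq_add2r j) -/K; apply: leq_trans (leq_pmull K e0) _.
lia.
Qed.

Lemma fermat_int p (a : int) : prime p -> (a ^+ p = a %[mod p])%Z.
Proof.
move=> p_pr; rewrite -modzXm -[RHS]modz_mod.
have p0 : (p : int) != 0 by rewrite eqz_nat -lt0n prime_gt0.
case: (a %% p)%Z (modz_ge0 a p0) => // b _.
have -> : (Posz b) ^+ p = Posz (b ^ p)%N by rewrite -[Posz b]natz -[RHS]natz natrX.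
by rewrite !modz_nat fermat_little.
Qed.

(** This is [lin_pow_congr] at [m = 0]; Fermat's little theorem replaces [coef_pow p x] by [x]. *)
Lemma lin_prime_pow p f x : prime p -> class_fun f ->
  (forall g, f (g ^+ p)%g = f g) -> (lin f (x ^+ p) = lin f x %[mod p])%Z.
Proof.
move=> p_pr cf fp; have := lin_pow_congr 0 x p_pr cf; rewrite expn1 => ->.
rewrite expn0 expr1; apply/eqP; rewrite eqz_mod_dvd /lin -sumrB.
apply: rpred_sum => g _; rewrite fp -mulrBl dvdz_mulr //.
by rewrite -eqz_mod_dvd {1}/gr_coef ffunE fermat_int.
Qed.

(* This replaces Galois conjugation: j is congruent modulo n to an integer whose
   prime factors p are so large that a congruence modulo p between values of f
   on powers of u is an equality. *)
Lemma lin_coprime_pow n f u j : class_fun f -> u ^+ n = 1 -> (0 < n)%N ->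
    coprime j n ->
    (forall p g, prime p -> ~~ (p %| #|gT|)%N -> f (g ^+ p)%g = f g) ->
  lin f (u ^+ j) = lin f u.
Proof.
move=> cf un n0 cjn fpow; case: (ltngtP n 1) => [|n1|n1]; first by case: n n0 {un cjn}.
  pose b := (\sum_(i < n) `|lin f (u ^+ i)|)%N.
  have bP i : (`|lin f (u ^+ i)| <= b)%N.
    rewrite -(expr_mod_order _ un); have h := ltn_pmod i n0.
    by rewrite /b (bigD1 (Ordinal h)) //= leq_addr.
  (* A prime above [B] does not divide the group order, and it exceeds the difference of any two
     values of [lin f] on powers of [u]. *)
  pose B := (#|gT| + (b + b))%N.
  have step p i : prime p -> (B < p)%N -> lin f (u ^+ (i * p)) = lin f (u ^+ i).
    move=> p_pr Bp; rewrite exprM; apply/eqP; rewrite -subr_eq0.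
    have pG : ~~ (p %| #|gT|)%N.
      apply/negP => /dvdn_leq; rewrite -cardsT cardG_gt0 => /(_ isT).
      by rewrite cardsT leqNgt (leq_ltn_trans _ Bp) // leq_addr.
    have := lin_prime_pow (u ^+ i) p_pr cf (fun g => fpow p g p_pr pG).
    move/eqP; rewrite eqz_mod_dvd => /dvdn_leq; rewrite absz_gt0 absz_nat.
    case: (_ =P 0) => //= _ /(_ isT); rewrite leqNgt => /negP [].
    have := bP i; have := bP (i * p)%N; rewrite exprM; lia.
  (* [M] collects the primes up to [B] that do not divide [n]. As [j'] is [j] modulo [n] and 1
     modulo [M], no prime up to [B] divides it. *)
  pose M := (B`!`_(\pi(n)^'))%N.
  have cnM : coprime n M by rewrite (pnat_coprime (pnat_pi n0)) ?part_pnat.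
  pose j' := chinese n M j 1.
  have j'n : j' = j %[mod n] by rewrite chinese_modl.
  have j'M : j' = 1 %[mod M] by rewrite chinese_modr.
  have cj'n : coprime j' n by rewrite -coprime_modl j'n coprime_modl.
  have cj'M : coprime j' M by rewrite -coprime_modl j'M coprime_modl coprime1n.
  have j'0 : (0 < j')%N.
    by rewrite lt0n; apply: contraTneq cj'n => ->; rewrite /coprime gcd0n; lia.
  have j'B r : prime r -> (r %| j')%N -> (B < r)%N.
    move=> r_pr rj; rewrite ltnNge; apply/negP => rB.
    have rn : ~~ (r %| n)%N.
      by rewrite -prime_coprime // (coprime_dvdl rj).
    have rM : (r %| M)%N.
      have rB' : (r %| B`!)%N by rewrite dvdn_fact // prime_gt0.
      rewrite /M -(@part_pnat_id (\pi(n)^') r) ?partn_dvd ?fact_gt0 //.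
      rewrite pnatE //= inE /= mem_primes r_pr n0 /=; exact: rn.
    by have := coprime_dvdl rj cj'M; rewrite prime_coprime // rM.
  have mul_step : forall k i, (0 < k)%N ->
      (forall r, prime r -> (r %| k)%N -> (B < r)%N) ->
      lin f (u ^+ (i * k)) = lin f (u ^+ i).
    elim/ltn_ind => k IH i k0 kB; case: (ltngtP k 1) => [|k1|->]; first by lia.
      have pk := pdiv_dvd k; have pp := pdiv_prime k1.
      rewrite -(divnK pk) mulnA step //; last by apply: kB.
      apply: IH => [||r rp rk]; first by rewrite ltn_Pdiv ?prime_gt1.
        by rewrite divn_gt0 ?pdiv_gt0 // dvdn_leq.
      by apply: kB => //; apply: dvdn_trans rk (dvdn_div pk).
    by rewrite muln1.
  by rewrite -(expr_mod_order _ un) -j'n (expr_mod_order _ un) -(mul1n j') mul_step.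
by move: un; rewrite n1 expr1 => ->; rewrite expr1n.
Qed.

End Torsion.

(** * Integer matrices and their reductions modulo 3 *)

Section IntMatrix.

(** In the Smith normal form keep only the nonzero invariant factors. [Z] consists of columns of an
    invertible matrix, hence is split; [J] has independent rows. *)
Lemma int_rank_factorization m n (F : 'M[int]_(m, n)) :
  exists r (Z : 'M[int]_(m, r)) (Z' : 'M[int]_(r, m)) (J : 'M[int]_(r, n)),
    [/\ F = Z *m J, Z' *m Z = 1%:M &
        forall k (x : 'M[int]_(k, r)), x *m J = 0 -> x = 0].
Proof.
have [L uL [R uR [d _ FE]]] := int_Smith_normal_form F.
pose I := [set k : 'I_m | (k < n)%N && (d`_k != 0)].
pose e (a : 'I_#|I|) : 'I_m := enum_val a.
have eI a : (e a < n)%N && (d`_(e a) != 0) by have := enum_valP a; rewrite inE.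
pose D : 'M[int]_(#|I|, n) := \matrix_(a, j) (d`_(e a) *+ (e a == j :> nat)).
exists #|I|, (\matrix_(i, a) L i (e a)), (\matrix_(a, i) invmx L (e a) i), (D *m R).
split.
- rewrite mulmxA {1}FE; congr (_ *m _); apply/matrixP => i j; rewrite !mxE.
  under [RHS]eq_bigr => a _ do rewrite !mxE.
  rewrite -(big_enum_val (fun k => L i k * (d`_k *+ (k == j :> nat)))) /=.
  rewrite (bigID [in I]) /= [X in _ + X]big1 ?addr0 => [|k].
    by apply: eq_bigr => k _; rewrite mxE.
  rewrite inE mxE negb_and negbK => /orP[kn|/eqP->]; last by rewrite mul0rn mulr0.
  by case: eqP => [e0|_]; rewrite ?mulr0 //; move: kn; rewrite e0 ltn_ord.
- apply/matrixP => a b; rewrite !mxE.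
  under eq_bigr => k _ do rewrite !mxE.
  have := congr1 (fun A : 'M[int]_m => A (e a) (e b)) (mulVmx uL).
  by rewrite !mxE => ->; rewrite (inj_eq enum_val_inj).
move=> k x /(congr1 (mulmx^~ (invmx R))); rewrite mul0mx -!mulmxA mulmxV // mulmx1.
move=> xD; apply/matrixP => i a; rewrite mxE.
have /andP[an da] := eI a.
have := congr1 (fun A : 'M[int]_(k, n) => A i (Ordinal an)) xD; rewrite !mxE.
rewrite (bigD1 a) //= !mxE eqxx mulr1n big1 ?addr0.
  by move/eqP; rewrite mulf_eq0 (negPf da) orbF => /eqP.
move=> b ba; rewrite mxE; case: eqP => [eab|_]; last by rewrite mulr0.
by move: ba; rewrite -(inj_eq enum_val_inj) -val_eqE /= -/(e b) -/(e a) eab eqxx.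
Qed.

(** With [D = Z *m J], cancelling [Z] and [J] shows that [J *m Z] is the scalar [c] of size [r], and
    it has the trace of [D]. *)
Lemma int_trace_quasi_idempotent n (D : 'M[int]_n) (c : int) :
  D *m D = c *: D -> exists2 r : nat, \tr D = c *+ r & (r = 0%N -> D = 0).
Proof.
have [r [Z [Z' [J [-> Z'Z Jinj]]]]] := int_rank_factorization D.
move=> /(congr1 (mulmx Z')); rewrite -scalemxAr !mulmxA Z'Z mul1mx.
move=> JZJ; have {JZJ} JZ : J *m Z = c%:M.
  apply/eqP; rewrite -subr_eq0; apply/eqP; apply: Jinj.
  by rewrite mulmxBl JZJ mul_scalar_mx subrr.
exists r; first by rewrite mxtrace_mulC JZ mxtrace_scalar.
by by move=> r0; rewrite r0 in Z J {JZ Z'Z Z' Jinj} *; rewrite [Z]thinmx0 mul0mx.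
Qed.

Local Notation bar := (map_mx (intr : int -> 'F_3)).

Lemma int_mx_mod3_lift m n (A : 'M['F_3]_(m, n)) : exists A' : 'M[int]_(m, n), bar A' = A.
Proof.
exists (\matrix_(i, j) (A i j : nat)%:Z); apply/matrixP => i j; rewrite !mxE.
by rewrite -[RHS]natr_Zp.
Qed.

Lemma intr_F3_eq0 (a : int) : (a%:~R == 0 :> 'F_3) = (3 %| a)%Z.
Proof.
case: a => a; first by rewrite -pmulrn -(dvdn_pcharf (pchar_Fp (isT : prime 3))).
rewrite NegzE mulrNz oppr_eq0 -pmulrn.
by rewrite -(dvdn_pcharf (pchar_Fp (isT : prime 3))) dvdzE abszN.
Qed.

Lemma int_mx_mod3_eq0 m n (A : 'M[int]_(m, n)) :
  bar A = 0 -> exists B : 'M[int]_(m, n), A = 3 *: B.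
Proof.
move=> A0; exists (\matrix_(i, j) (A i j %/ 3)%Z); apply/matrixP => i j.
rewrite !mxE mulrC divzK // -intr_F3_eq0; apply/eqP.
by have := congr1 (fun B : 'M['F_3]_(m, n) => B i j) A0; rewrite !mxE.
Qed.

(* On the lattice spanned by the rows of J, F acts as S = J Z, where S / q is a
   root of X^2 + 3 X + 3, like omega - 1. Modulo 3, the kernel of S is its image,
   and it contains the kernel of J. *)
Lemma int_trace_rank3 n (F : 'M[int]_n) (q : int) : ~~ (3 %| q)%Z ->
    F *m F *m F + (3 * q) *: (F *m F) + (3 * q ^+ 2) *: F = 0 ->
  \tr (F *m F + (3 * q) *: F) =
    - (6 * q ^+ 2) * ((\rank (bar F))%:Z - (\rank (bar F *m bar F))%:Z).
Proof.
move=> q3; have [r [Z [Z' [J [-> Z'Z Jinj]]]]] := int_rank_factorization F.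
set S := J *m Z => F3.
have S2 : S *m S + (3 * q) *: S = - (3 * q ^+ 2)%:M.
  apply/eqP; rewrite -subr_eq0 opprK; apply/eqP; apply: Jinj.
  have := congr1 (mulmx Z') F3; rewrite mulmx0 !mulmxDr -!scalemxAr !mulmxA Z'Z !mul1mx.
  by rewrite !mulmxDl -!scalemxAl mul_scalar_mx.
have -> : \tr (Z *m J *m (Z *m J) + (3 * q) *: (Z *m J)) = - (3 * q ^+ 2) *+ r.
  have := congr1 mxtrace S2; rewrite raddfN /= mxtrace_scalar mulNrn => <-.
  rewrite !mxtraceD !mxtraceZ.
  by rewrite (mxtrace_mulC Z J) -mulmxA (mxtrace_mulC Z) /S !mulmxA.
have S2' : S *m (S + (3 * q)%:M) = - (3 * q ^+ 2)%:M.
  by rewrite mulmxDr mul_mx_scalar.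
have bar3 a b (A : 'M[int]_(a, b)) : bar (3 *: A) = 0.
  by apply/matrixP => i j; rewrite !mxE rmorphM /= (_ : 3%:~R = 0) ?mul0r //; apply: val_inj.
have q3' : (q%:~R : 'F_3) != 0.
  by rewrite intr_F3_eq0.
pose c : 'F_3 := - (q%:~R ^+ 2).
have c0 : c != 0 by rewrite oppr_eq0 expf_neq0.
(* Multiplying by [S + 3 q], whose product with [S] is [- 3 q ^ 2], and cancelling 3 solves for [x]
   modulo 3. *)
have div3 k (x : 'M[int]_(k, r)) y : x *m S = 3 *: y ->
    c *: bar x = bar y *m bar S.
  move=> xS; have : 3 *: (y *m (S + (3 * q)%:M) + q ^+ 2 *: x) = 0.
    rewrite scalerDr scalemxAl -xS -mulmxA S2' scalerA mulmxN mul_mx_scalar.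
    by rewrite addNr.
  move/eqP; rewrite scalemx_eq0 /= addr_eq0 => /eqP.
  move/(congr1 (fun A => bar A)); rewrite map_mxM map_mxN map_mxZ map_mxD.
  rewrite -scalemx1 -scalerA bar3 addr0 => ->.
  by rewrite rmorphXn /= scaleNr.
have barS2 : bar S *m bar S = 0.
  rewrite -map_mxM (_ : S *m S = - (3 * q ^+ 2)%:M - (3 * q) *: S); last first.
  by rewrite -S2 addrK.
by rewrite -scalemx1 -!scalerA -scalerN -scalerBr bar3.
have sub_barS k (x : 'M['F_3]_(k, r)) : x *m bar J = 0 -> (x <= bar S)%MS.
  have [x' <-] := int_mx_mod3_lift x; rewrite -map_mxM => /int_mx_mod3_eq0 [y xJ].
  have /div3 : x' *m S = 3 *: (y *m Z) by rewrite /S mulmxA xJ scalemxAl.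
  by move=> cx; rewrite -(eqmx_scale _ c0) cx submxMl.
have kerS : (kermx (bar S) :=: bar S)%MS.
  apply/eqmxP/andP; split; last by apply/sub_kermxP.
  have [x xE] := int_mx_mod3_lift (kermx (bar S)); rewrite -xE.
  have : bar (x *m S) = 0 by rewrite map_mxM xE mulmx_ker.
  move=> /int_mx_mod3_eq0 [y /div3 cx]; rewrite -(eqmx_scale _ c0) cx; exact: submxMl.
have kerJ : (kermx (bar J) <= bar S)%MS by apply: sub_barS; rewrite mulmx_ker.
have rS : r = (2 * \rank (bar S))%N.
  have := mxrank_ker (bar S); rewrite kerS; have := rank_leq_row (bar S); lia.
have rZ k (A : 'M[int]_(r, k)) : \rank (bar (Z *m A)) = \rank (bar A).
  apply/eqP; rewrite eqn_leq map_mxM mxrankM_maxr /=.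
  rewrite -[X in (\rank X <= _)%N]mul1mx -(map_mx1 intr) -Z'Z map_mxM -mulmxA.
  exact: mxrankM_maxr.
have ZJZJ : Z *m J *m (Z *m J) = Z *m (S *m J) by rewrite /S !mulmxA.
rewrite -[bar (Z *m J) *m _]map_mxM ZJZJ !rZ map_mxM.
(* Since the kernel of [bar J] lies in the image of [bar S], passing from [bar J] to its product
   with [bar S] loses rank [r - \rank (bar S)], which is [r / 2]. *)
have := mxrank_mul_ker (bar S) (bar J).
have /capmx_idPr/eqmxP/eqmx_rank -> := kerJ.
rewrite mxrank_ker; have := rank_leq_row (bar J).
move=> h1 h2; rewrite {1}rS; move: h1 h2 rS.
move: (\rank _) (\rank _) (\rank _) => a b d h1 h2 h3.
have -> : (d%:Z - b%:Z) = a%:Z by lia.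
rewrite -mulr_natr; ring.
Qed.
End IntMatrix.

(** * The regular representation *)

Section RegularRepresentation.
Variables (R : comNzRingType) (gT : finGroupType).
Implicit Types (x y z m : groupRing R gT).

Definition gr_vec x : 'rV[R]_#|gT| := \row_i gr_coef x (enum_val i).
(** Matrices act on row vectors, so left multiplication becomes an antihomomorphism and right
    multiplication a homomorphism. *)
Definition gr_lmx x : 'M[R]_#|gT| :=
  \matrix_(i, j) gr_coef x (enum_val j * (enum_val i)^-1)%g.
Definition gr_rmx x : 'M[R]_#|gT| :=
  \matrix_(i, j) gr_coef x ((enum_val i)^-1 * enum_val j)%g.

Lemma gr_vec_inj : injective gr_vec.
Proof.
move=> x y exy; apply: gr_coefP => g.
by have := congr1 (fun v : 'rV_#|gT| => v 0 (enum_rank g)) exy; rewrite !mxE enum_rankK.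
Qed.

Lemma gr_vec_surj (v : 'rV[R]_#|gT|) : exists x, v = gr_vec x.
Proof.
exists [ffun g => v 0 (enum_rank g)]; apply/rowP => i.
by rewrite mxE /gr_coef ffunE enum_valK.
Qed.

Lemma gr_vec0 : gr_vec 0 = 0.
Proof. by apply/rowP => i; rewrite !mxE gr_coef0. Qed.

Lemma gr_vec_rmx m z : gr_vec m *m gr_rmx z = gr_vec (m * z).
Proof.
apply/rowP => j; rewrite !mxE gr_coef_mul (reindex _ (onW_bij _ (enum_val_bij gT))) /=.
by apply: eq_bigr => i _; rewrite !mxE.
Qed.

Lemma gr_vec_lmx m x : gr_vec m *m gr_lmx x = gr_vec (x * m).
Proof.
apply/rowP => j; rewrite !mxE gr_coef_mul_r (reindex _ (onW_bij _ (enum_val_bij gT))) /=.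
by apply: eq_bigr => i _; rewrite !mxE mulrC.
Qed.

Lemma gr_mx_ext k (A B : 'M[R]_(#|gT|, k)) :
  (forall m, gr_vec m *m A = gr_vec m *m B) -> A = B.
Proof.
move=> AB; apply/row_matrixP => i; rewrite !rowE.
by have [m ->] := gr_vec_surj (delta_mx 0 i).
Qed.

Lemma gr_rmxM x y : gr_rmx (x * y) = gr_rmx x *m gr_rmx y.
Proof. by apply: gr_mx_ext => m; rewrite mulmxA !gr_vec_rmx mulrA. Qed.

Lemma gr_lmxM x y : gr_lmx (x * y) = gr_lmx y *m gr_lmx x.
Proof. by apply: gr_mx_ext => m; rewrite mulmxA !gr_vec_lmx mulrA. Qed.

Lemma gr_lmx_rmxC x z : gr_lmx x *m gr_rmx z = gr_rmx z *m gr_lmx x.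
Proof.
by apply: gr_mx_ext => m; rewrite !mulmxA !(gr_vec_lmx, gr_vec_rmx) mulrA.
Qed.

Lemma gr_lmxD x y : gr_lmx (x + y) = gr_lmx x + gr_lmx y.
Proof. by apply/matrixP => i j; rewrite !mxE gr_coefD. Qed.

Lemma gr_lmxMn x n : gr_lmx (x *+ n) = n%:R *: gr_lmx x.
Proof. by apply/matrixP => i j; rewrite !mxE gr_coefMn mulr_natl. Qed.

Lemma gr_lmx_inj : injective gr_lmx.
Proof.
move=> x y exy; apply: gr_vec_inj.
by rewrite -[x]mulr1 -[y]mulr1 -!gr_vec_lmx exy.
Qed.

Lemma mxtrace_lmx x : \tr (gr_lmx x) = gr_coef x 1%g *+ #|gT|.
Proof.
rewrite /mxtrace; under eq_bigr => i _ do rewrite mxE mulgV.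
by rewrite sumr_const card_ord.
Qed.

(** This is the trace of [m] mapped to [x * m * z]: the term [k h g] contributes at [h] exactly when
    [g] is the conjugate of [k^-1] by [h]. *)
Lemma mxtrace_lmx_rmx x z : \tr (gr_lmx x *m gr_rmx z) =
  lin (fun k => \sum_g gr_coef z (k^-1 ^ g)%g) x.
Proof.
rewrite /lin; under [RHS]eq_bigr => k _ do rewrite mulr_sumr.
rewrite [RHS]exchange_big /mxtrace /= [RHS](reindex _ (onW_bij _ (enum_val_bij gT))) /=.
apply: eq_bigr => i _; rewrite mxE.
rewrite (reindex _ (onW_bij _ (enum_rank_bij gT))) /=.
rewrite [RHS](reindex_inj (mulIg (enum_val i)^-1%g)) /=.
apply: eq_bigr => g _; rewrite !mxE enum_rankK; congr (_ * gr_coef z _).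
by rewrite conjgE invMg invgK -mulgA mulKg.
Qed.

End RegularRepresentation.

Lemma sum_const_tail n (E : nat -> int) a : (0 < n)%N ->
    (forall i, (0 < i)%N -> (i < n)%N -> E i = a) ->
  \sum_(i < n) E i = E 0%N + a *+ n.-1.
Proof.
case: n => // n _ Ea; rewrite big_ord_recl; congr (_ + _).
rewrite (eq_bigr (fun=> a)) ?sumr_const ?card_ord // => i _.
by apply: Ea => //; rewrite /= /bump leq0n add1n ltnS.
Qed.

(** * Coefficients at 1 of torsion units *)

Section BermanHigman.
Variable gT : finGroupType.
Implicit Types (z u : groupRing int gT).

(* Multiplication by z on the group ring has trace #|gT| times the coefficient
   of z at 1. *)
Lemma quasi_idempotent_coef1 z c : (0 < c)%N -> z * z = z *+ c ->
  0 <= gr_coef z 1%g /\ (gr_coef z 1%g = 0 -> z = 0).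
Proof.
move=> c0 zz; have : gr_lmx z *m gr_lmx z = c%:R *: gr_lmx z.
  by rewrite -gr_lmxM zz gr_lmxMn.
case/int_trace_quasi_idempotent => r; rewrite mxtrace_lmx => trz z0.
have G0 : (0 < #|gT|)%N by rewrite -cardsT cardG_gt0.
split; first by rewrite -(pmulrn_lge0 _ G0) trz mulrn_wge0.
move=> z1; apply/gr_lmx_inj; rewrite z0.
  by apply/matrixP => i j; rewrite !mxE gr_coef0.
move/eqP: trz; rewrite z1 mul0rn eq_sym mulrn_eq0 => /orP[/eqP//|].
by rewrite pnatr_eq0; lia.
Qed.

Definition norm_elt u n : groupRing int gT := \sum_(i < n) u ^+ i.

Lemma norm_eltMl u n : u ^+ n = 1 -> u * norm_elt u n = norm_elt u n.
Proof.
case: n => [|n] un; first by rewrite /norm_elt big_ord0 mulr0.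
rewrite /norm_elt mulr_sumr big_ord_recr big_ord_recl /= -exprS un addrC.
by congr (_ + _); apply: eq_bigr => i _; rewrite -exprS.
Qed.

Lemma norm_eltXl u n k : u ^+ n = 1 -> u ^+ k * norm_elt u n = norm_elt u n.
Proof.
move=> un; elim: k => [|k IH]; first by rewrite expr0 mul1r.
by rewrite exprSr -mulrA norm_eltMl.
Qed.

Lemma norm_eltM u n : u ^+ n = 1 -> norm_elt u n * norm_elt u n = norm_elt u n *+ n.
Proof.
move=> un; rewrite {1}/norm_elt mulr_suml.
under eq_bigr => i _ do rewrite norm_eltXl //.
by rewrite sumr_const card_ord.
Qed.

Lemma augmentation_norm_elt u n : augmentation u = 1 -> augmentation (norm_elt u n) = n%:R.
Proof.
move=> au; rewrite augmentationE /norm_elt lin_sum.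
under eq_bigr => i _ do rewrite -augmentationE augmentationX au expr1n.
by rewrite sumr_const card_ord.
Qed.

Let coef1 : gT -> int := fun g => (g == 1%g)%:R.

Lemma lin_coef1 z : lin coef1 z = gr_coef z 1%g.
Proof.
rewrite /lin (bigD1 1%g) //= /coef1 eqxx mulr1 big1 ?addr0 // => g /negPf ->.
by rewrite mulr0.
Qed.

Lemma coef1_coprime_pow u n j : u ^+ n = 1 -> (0 < n)%N -> coprime j n ->
  gr_coef (u ^+ j) 1%g = gr_coef u 1%g.
Proof.
move=> un n0 cjn; rewrite -!lin_coef1; apply: (lin_coprime_pow _ un n0 cjn).
  move=> g h; rewrite /coef1; congr (nat_of_bool _)%:R.
  by rewrite -!eq_invg_mul eq_invg_sym eq_sym.
move=> p g p_pr pG; rewrite /coef1; congr (nat_of_bool _)%:R.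
apply/eqP/eqP => [gp|->]; last by rewrite expg1n.
apply/eqP; rewrite -order_eq1 -dvdn1.
have : coprime p #[g]%g.
  rewrite prime_coprime //; apply: contra pG => /dvdn_trans; apply.
  by rewrite -cardsT order_dvdG ?inE.
by move=> cpg; rewrite -(Gauss_dvdr 1 (n := p)) ?muln1 1?coprime_sym // order_dvdn gp.
Qed.

(** [N] and [p - N] are nonzero quasi-idempotents, so their coefficients at 1 are positive:
    [0 < 1 + (p - 1) c < p], which forces [c = 0]. *)
Lemma coef1_prime_order u p : prime p -> u ^+ p = 1 -> u != 1 -> augmentation u = 1 ->
  gr_coef u 1%g = 0.
Proof.
move=> p_pr up u1 au; have p0 := prime_gt0 p_pr; have p1 := prime_gt1 p_pr.
set c := gr_coef u 1%g; set N := norm_elt u p.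
have NE : gr_coef N 1%g = 1 + c *+ p.-1.
  rewrite /N /norm_elt gr_coef_sum -(prednK p0) big_ord_recl gr_coef_one eqxx /=.
  congr (_ + _); rewrite (eq_bigr (fun=> c)) ?sumr_const ?card_ord // => i _.
  apply: (coef1_coprime_pow up p0); rewrite coprime_sym prime_coprime //.
  by apply/negP => /dvdn_leq; rewrite /bump /=; have := ltn_ord i; lia.
have NN : N * N = N *+ p by apply: norm_eltM.
have [N0 Nn0] := quasi_idempotent_coef1 p0 NN.
have NN' : (p%:R - N) * (p%:R - N) = (p%:R - N) *+ p.
  by rewrite mulrBl mulr_natl [N * _]mulrBr NN mulr_natr subrr subr0.
have [N0' Nn0'] := quasi_idempotent_coef1 p0 NN'.
have NE' : gr_coef (p%:R - N) 1%g = p%:R - gr_coef N 1%g.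
  by rewrite gr_coefD gr_coefN gr_coefMn gr_coef_one eqxx.
have NE0 : gr_coef N 1%g != 0.
  apply: contraTneq isT => /Nn0 N_0; have := augmentation_norm_elt p au.
  rewrite -/N N_0 augmentationE lin0 => /eqP; rewrite eq_sym pnatr_eq0; lia.
(* If [N = p], then [u * N = N] gives [p u = p], hence [u = 1]. *)
have NE0' : gr_coef (p%:R - N) 1%g != 0.
  apply: contra u1 => /eqP/Nn0' /eqP; rewrite subr_eq0 => /eqP pN.
  have := norm_eltMl up; rewrite -/N -pN mulr_natr => /eqP.
  rewrite -subr_eq0 -mulrnBl => /eqP u0; rewrite -subr_eq0; apply/eqP/gr_coefP => g.
  have /eqP := congr1 (fun x => gr_coef x g) u0.
  by rewrite gr_coefMn gr_coef0 mulrn_eq0 => /orP[|/eqP//]; lia.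
move: N0 N0' NE0 NE0'; rewrite NE' NE -mulr_natr; nia.
Qed.

(** The quasi-idempotents [Nv * Nw] and [Nv * (q - Nw)] give [0 <= 1 + c (p - 1) (q - 1) <= q].
    Hence [c (p - 1) <= 1], and [c = 0] because [p - 1] is at least 2. *)
Lemma coef1_order_prod u p q : prime p -> prime q -> p != q -> (2 < p)%N ->
    u ^+ (p * q) = 1 -> u ^+ p != 1 -> u ^+ q != 1 -> augmentation u = 1 ->
  gr_coef u 1%g = 0.
Proof.
move=> p_pr q_pr pq p2 upq up uq au.
have p0 := prime_gt0 p_pr; have q0 := prime_gt0 q_pr.
have p1 := prime_gt1 p_pr; have q1 := prime_gt1 q_pr.
have cpq : coprime p q by rewrite prime_coprime // dvdn_prime2.
pose v := u ^+ q; pose w := u ^+ p.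
have vp : v ^+ p = 1 by rewrite /v -exprM mulnC.
have wq : w ^+ q = 1 by rewrite /w -exprM.
set c := gr_coef u 1%g.
(* The product is a power of [u]. If just one exponent vanishes, the prime order case applies; if
   none does, the total exponent is prime to [p * q]. *)
have coefE i j : (i < p)%N -> (j < q)%N -> gr_coef (v ^+ i * w ^+ j) 1%g =
   if i == 0%N then (j == 0%N)%:R else if j == 0%N then 0 else c.
  move=> ip jq; have qi_p : (0 < i)%N -> coprime (q * i + p * j) p.
    move=> i0; rewrite coprime_sym addnC [(p * j)%N]mulnC /coprime gcdnMDl -/(coprime _ _).
    rewrite coprimeMr cpq prime_coprime //.
    by apply/negP => /dvdn_leq; rewrite i0 => /(_ isT); rewrite leqNgt ip.
  have pj_q : (0 < j)%N -> coprime (q * i + p * j) q.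
    move=> j0; rewrite coprime_sym [(q * i)%N]mulnC /coprime gcdnMDl -/(coprime _ _).
    rewrite coprimeMr [coprime q p]coprime_sym cpq prime_coprime //.
    by apply/negP => /dvdn_leq; rewrite j0 => /(_ isT); rewrite leqNgt jq.
  have -> : v ^+ i * w ^+ j = u ^+ (q * i + p * j) by rewrite exprD !exprM.
  case: (posnP i) => [->|i0]; case: (posnP j) => [->|j0].
  - by rewrite !muln0 expr0 gr_coef_one eqxx.
  - rewrite muln0 add0n exprM -/w (coef1_coprime_pow wq) //.
      by rewrite (coef1_prime_order q_pr wq) ?augmentationX ?au ?expr1n.
    rewrite coprime_sym prime_coprime //.
    by apply/negP => /dvdn_leq; rewrite j0 => /(_ isT); rewrite leqNgt jq.
  - rewrite muln0 addn0 exprM -/v (coef1_coprime_pow vp) //.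
      by rewrite (coef1_prime_order p_pr vp) ?augmentationX ?au ?expr1n.
    rewrite coprime_sym prime_coprime //.
    by apply/negP => /dvdn_leq; rewrite i0 => /(_ isT); rewrite leqNgt ip.
  rewrite (coef1_coprime_pow upq) ?muln_gt0 ?p0 //.
  by rewrite coprimeMr qi_p ?pj_q.
pose Nv := norm_elt v p; pose Nw := norm_elt w q.
have coefv i : (i < p)%N -> gr_coef (v ^+ i) 1%g = (i == 0%N)%:R.
  move=> ip; rewrite -[v ^+ i]mulr1 -[1 in LHS](expr0 w) coefE // eqxx.
  by case: (i == 0%N).
have NvE : gr_coef Nv 1%g = 1.
  rewrite /Nv /norm_elt gr_coef_sum (@sum_const_tail p (fun i => gr_coef (v ^+ i) 1%g) 0) //.
    by rewrite coefv // mul0rn addr0.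
  by move=> i i0 ip; rewrite coefv // (gtn_eqF i0).
have NvwE : gr_coef (Nv * Nw) 1%g = 1 + c *+ (p.-1 * q.-1).
  have inner i : (i < p)%N -> gr_coef (v ^+ i * Nw) 1%g =
      if i == 0%N then 1 else c *+ q.-1.
    move=> ip; rewrite mulr_sumr gr_coef_sum.
    pose a := if i == 0%N then 0 else c.
    rewrite (@sum_const_tail q (fun j => gr_coef (v ^+ i * w ^+ j) 1%g) a) //.
      rewrite coefE // /a; case: (i == 0%N); first by rewrite mul0rn addr0.
      by rewrite add0r.
    by move=> j j0 jq; rewrite coefE // /a (gtn_eqF j0).
  rewrite mulr_suml gr_coef_sum.
  rewrite (@sum_const_tail p (fun i => gr_coef (v ^+ i * Nw) 1%g) (c *+ q.-1)) //.
    by rewrite inner // -mulrnA mulnC.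
  by move=> i i0 ip; rewrite inner // (gtn_eqF i0).
have comm_N : GRing.comm Nv Nw.
  apply: commr_sum => j _; apply: commr_sym; apply: commr_sum => i _.
  by rewrite /GRing.comm -!exprM -!exprD addnC.
have NvNv : Nv * Nv = Nv *+ p by apply: norm_eltM.
have NwNw : Nw * Nw = Nw *+ q by apply: norm_eltM.
have quasi X : Nv * X = X * Nv -> X * X = X *+ q ->
    (Nv * X) * (Nv * X) = (Nv * X) *+ (p * q).
  move=> cX XX; rewrite mulrA -[Nv * X * Nv]mulrA -cX mulrA NvNv -mulrA XX.
  by rewrite mulrnAl mulrnAr -mulrnA mulnC.
have pq0 : (0 < p * q)%N by rewrite muln_gt0 p0.
have [c1 _] := quasi_idempotent_coef1 pq0 (quasi _ comm_N NwNw).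
have [||c2 _] := quasi_idempotent_coef1 pq0 (quasi (q%:R - Nw) _ _).
- by rewrite mulrBl mulrBr comm_N mulr_natl mulr_natr.
- by rewrite mulrBl mulr_natl [Nw * _]mulrBr NwNw mulr_natr subrr subr0.
move: c1 c2; rewrite mulrBr mulr_natr gr_coefD gr_coefN gr_coefMn NvE NvwE.
rewrite -[c *+ _]mulr_natr; have : (2 <= p.-1)%N by lia.
have : (1 <= q.-1)%N by lia.
move: (p.-1) (q.-1) (prednK q0) => a b <- b1 a2.
rewrite ?natz => c1 c2.
have {}c2 : c * (a * b)%N%:Z <= b%:Z by lia.
have ab : (2 * b <= a * b)%N by rewrite leq_mul2r a2 orbT.
move: (a * b)%N ab c1 c2 => d bd c1 c2.
have h1 : c <= 0 by nia.
have h2 : 0 <= c by nia.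
by lia.
Qed.
End BermanHigman.

(** * Sums of partial augmentations over element orders *)

Section PartialAugmentations.
Variable gT : finGroupType.
Implicit Types (u : groupRing int gT) (f : gT -> int) (g h : gT).

Lemma order_mulC g h : #[g * h]%g = #[h * g]%g.
Proof.
have -> : (g * h = (h * g) ^ h)%g by rewrite conjgE -mulgA mulKg.
exact: orderJ.
Qed.

Lemma class_fun_order (F : nat -> int) : class_fun (fun g => F #[g]%g).
Proof. by move=> g h; rewrite order_mulC. Qed.

Lemma lin_sumf (I : finType) (F : I -> gT -> int) u :
  lin (fun g => \sum_i F i g) u = \sum_i lin (F i) u.
Proof.
rewrite /lin exchange_big; apply: eq_bigr => g _ /=.
by rewrite mulr_sumr.
Qed.

Lemma eq_lin f f' u : f =1 f' -> lin f u = lin f' u.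
Proof. by move=> ff'; apply: eq_bigr => g _; rewrite ff'. Qed.

(** Split [F] according to the least prime factor [p] of the part of the order prime to [n]; each
    piece lives on elements of order divisible by [p], so [lin_singular_eq0] applies. *)
Lemma lin_support_eq0 n (F : nat -> int) u : (0 < n)%N -> u ^+ n = 1 ->
    (forall k, \pi(n).-nat k -> F k = 0) -> lin (fun g => F #[g]%g) u = 0.
Proof.
move=> n0 un Fn; pose e k := pdiv k`_(\pi(n)^').
pose E (p : 'I_#|gT|.+1) k : int := F k *+ (e k == p).
have eG g : (e #[g]%g < #|gT|.+1)%N.
  rewrite ltnS; apply: leq_trans (pdiv_leq (part_gt0 _ _)) _.
  apply: leq_trans (dvdn_leq (order_gt0 g) (dvdn_part _ _)) _.
  by rewrite -cardsT dvdn_leq ?cardG_gt0 // order_dvdG ?inE.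
rewrite (@eq_lin _ (fun g => \sum_p E p #[g]%g)).
  rewrite (lin_sumf (fun p g => E p #[g]%g)) big1 // => p _.
  case: (boolP (prime p && ~~ (p %| n)%N)) => [/andP[p_pr pn]|pp].
    apply: (@lin_singular_eq0 _ p n) => //; first by rewrite prime_coprime.
      exact: (@class_fun_order (E p)).
    move=> g; rewrite /E; case: (e _ =P p :> nat) => [<- _|_]; last by rewrite eqxx.
    by apply: dvdn_trans (pdiv_dvd _) (dvdn_part _ _).
  (* For other [p], [e] takes the value [p] only at [\pi(n)]-numbers, where [F] vanishes. *)
  rewrite (@eq_lin _ (fun=> 0)); first by rewrite /lin big1 // => g _; rewrite mulr0.
  move=> g; rewrite /E; case: eqP => [ep|]; last by rewrite mulr0n.
  rewrite Fn ?mul0rn //; apply: contraR pp => nng.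
  have k1 : (1 < #[g]%g`_(\pi(n)^'))%N.
    rewrite ltn_neqAle part_gt0 andbT eq_sym; apply: contra nng => /eqP k1.
    rewrite -(partnC \pi(n) (order_gt0 g)) k1 muln1; exact: part_pnat.
  have p_pr := pdiv_prime k1; rewrite -/(e _) ep in p_pr; rewrite p_pr /=.
  have pk : (p %| #[g]%g`_(\pi(n)^'))%N by rewrite -ep pdiv_dvd.
  have := pnatP _ (part_gt0 _ _) (part_pnat (\pi(n)^') #[g]%g) p p_pr pk.
  by rewrite !inE /= mem_primes p_pr n0.
move=> g; rewrite (bigD1 (Ordinal (eG g))) //= /E eqxx mulr1n big1 ?addr0 // => p.
by rewrite -val_eqE /= eq_sym => /negPf ->.
Qed.

(** The indicator of the [p]-singular elements; [lin (sing 3)] is the function [s] of the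
    overview. *)
Definition sing p g : int := (p %| #[g]%g)%:R.

Lemma lin_sing_coprime p n u : prime p -> coprime p n -> u ^+ n = 1 ->
  lin (sing p) u = 0.
Proof.
move=> p_pr cpn un; apply: (lin_singular_eq0 p_pr cpn un).
  exact: (@class_fun_order (fun k => (p %| k)%:R)).
by move=> g; rewrite /sing; case: (p %| _)%N => //; rewrite eqxx.
Qed.

Lemma lin_order_eq (F : nat -> int) u : lin (fun g => F #[g]%g) u = 0 ->
  lin (fun g => 1 - (#[g]%g == 1%N)%:R - F #[g]%g) u = augmentation u - gr_coef u 1%g.
Proof.
move=> F0; rewrite -(lin_coef1 u) augmentationE -[RHS]subr0 -F0 /lin -!sumrB.
apply: eq_bigr => g _; rewrite !mulrBr mulr1 order_eq1; ring.
Qed.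

(** On powers of [p], being divisible by [p] means being different from 1. So [sing p] captures the
    whole augmentation except the coefficient at 1, which is 0. *)
Lemma lin_sing_prime_order p u : prime p -> u ^+ p = 1 -> u != 1 -> augmentation u = 1 ->
  lin (sing p) u = 1.
Proof.
move=> p_pr up u1 au; pose F k : int := 1 - (k == 1%N)%:R - (p %| k)%:R.
have F0 : lin (fun g => F #[g]%g) u = 0.
  apply: (lin_support_eq0 (prime_gt0 p_pr) up) => k.
  rewrite (eq_pnat _ (pi_of_prime p_pr)) => /p_natP [j ->]; rewrite /F.
  case: j => [|j]; first by rewrite expn0 eqxx dvdn1; case: eqP p_pr => // ->.
  by rewrite expnS dvdn_mulr // muln_eq1; case: eqP p_pr => // ->.
rewrite -[RHS]subr0 -au -(coef1_prime_order p_pr up u1 au) -(lin_order_eq F0).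
by apply: eq_lin => g; rewrite /sing /F; ring.
Qed.

(** As for one prime; [F] is set to 0 at multiples of [p * q] so that it vanishes on all
    [{p, q}]-numbers, and the group has no elements of such orders. *)
Lemma lin_sing_two_primes p q u : prime p -> prime q -> p != q -> (2 < p)%N ->
    u ^+ (p * q) = 1 -> u ^+ p != 1 -> u ^+ q != 1 -> augmentation u = 1 ->
    (forall g, ~~ (p * q %| #[g]%g)%N) ->
  lin (sing p) u + lin (sing q) u = 1.
Proof.
move=> p_pr q_pr pq p2 upq up uq au noG.
pose F k : int :=
  if (p * q %| k)%N then 0 else 1 - (k == 1%N)%:R - ((p %| k)%:R + (q %| k)%:R).
have pq0 : (0 < p * q)%N by rewrite muln_gt0 !prime_gt0.
have cpq : coprime p q by rewrite prime_coprime // dvdn_prime2.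
have F0 : lin (fun g => F #[g]%g) u = 0.
  apply: (lin_support_eq0 pq0 upq) => k kpi; rewrite /F.
  have k0 : (0 < k)%N by case/andP: kpi.
  rewrite Gauss_dvd //.
  case: (boolP (p %| k)%N) => pk; case: (boolP (q %| k)%N) => qk //=.
  - have -> : (k == 1%N) = false.
      by apply: contraTF pk => /eqP ->; rewrite dvdn1; case: eqP p_pr => // ->.
    by [].
  - have -> : (k == 1%N) = false.
      by apply: contraTF qk => /eqP ->; rewrite dvdn1; case: eqP q_pr => // ->.
    by [].
  suff -> : k = 1%N by [].
  apply/eqP; apply: contraTT kpi => k1; have k1' : (1 < k)%N by lia.
  apply/negP => /pnatP => /(_ k0 _ (pdiv_prime k1') (pdiv_dvd k)).
  rewrite /= !inE /= mem_primes => /and3P[r_pr _].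
  rewrite Euclid_dvdM // !dvdn_prime2 // => /orP[]/eqP e.
    by rewrite -e pdiv_dvd in pk.
  by rewrite -e pdiv_dvd in qk.
rewrite -[RHS]subr0 -au -(coef1_order_prod p_pr q_pr pq p2 upq up uq au).
rewrite -(lin_order_eq F0) /lin -big_split; apply: eq_bigr => g _ /=.
by rewrite /F (negPf (noG g)) /sing -mulrDr; congr (_ * _); ring.
Qed.

End PartialAugmentations.

(** * Lattices induced from a linear character with values 1 and -1 *)

Section CosetLattice.

Local Notation bar := (map_mx (intr : int -> 'F_3)).

Lemma mxrank_inverse_sides (k : fieldType) m n p r (P' : 'M[k]_(n, m)) (P : 'M_(m, n))
    (A : 'M_(n, p)) (Q : 'M_(p, r)) (Q' : 'M_(r, p)) :
  P' *m P = 1%:M -> Q *m Q' = 1%:M -> \rank (P *m A *m Q) = \rank A.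
Proof.
move=> P'P QQ'; apply/eqP; rewrite eqn_leq; apply/andP; split.
  exact: leq_trans (mxrankM_maxl _ _) (mxrankM_maxr _ _).
have -> : \rank A = \rank (P' *m (P *m A *m Q) *m Q').
  by rewrite !mulmxA P'P mul1mx -mulmxA QQ' mulmx1.
exact: leq_trans (mxrankM_maxl _ _) (mxrankM_maxr _ _).
Qed.

(** When [lam] is a linear character of [H] with values 1 and -1, the left ideal generated by this
    element is the lattice induced from it. *)
Definition sum_twist (R : nzRingType) (gT : finGroupType) (H : {set gT})
    (lam : gT -> int) : groupRing R gT := [ffun g => (lam g)%:~R *+ (g \in H)].

Lemma gr_coef_twist (R : nzRingType) (gT : finGroupType) (H : {set gT}) lam g :
  gr_coef (sum_twist R H lam) g = (lam g)%:~R *+ (g \in H).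
Proof. by rewrite /gr_coef ffunE. Qed.

Variables (gT : finGroupType) (H : {group gT}) (lam : gT -> int).
Hypothesis lamM : {in H &, forall g h, lam (g * h)%g = lam g * lam h}.
Hypothesis lam2 : {in H, forall g, lam g * lam g = 1}.

Local Notation sH := (sum_twist int H lam).

Lemma twist_sign1 : lam 1%g = 1.
Proof.
by have h1 := group1 H; rewrite -{1}(mulg1 1%g) lamM // lam2.
Qed.

Lemma sum_twistM : sH * sH = sH *+ #|H|.
Proof.
apply: gr_coefP => g; rewrite gr_coef_mul gr_coefMn gr_coef_twist.
rewrite (bigID [in H]) /= [X in _ + X]big1 ?addr0 => [|h /negPf hH]; last first.
  by rewrite gr_coef_twist hH mul0r.
rewrite (eq_bigr (fun=> (lam g)%:~R *+ (g \in H))) ?sumr_const // => h hH.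
rewrite !gr_coef_twist hH mulr1n groupMl ?groupV //.
case: (boolP (g \in H)) => gH; last by rewrite mulr0.
by rewrite !intz !mulr1n -lamM ?groupM ?groupV // mulKVg.
Qed.

(** [T] is a transversal of the left cosets of [H]. The rows of [X^T] are the translates of [sH] by
    [T], a basis of the left ideal; [X'^T] reads off the values on [T]. *)
Let T := [set g : gT | repr (g *: H)%g == g].
Let e (a : 'I_#|T|) : gT := enum_val a.
Let X : 'M[int]_(#|gT|, #|T|) := \matrix_(i, a) gr_coef sH ((e a)^-1 * enum_val i)%g.
Let X' : 'M[int]_(#|T|, #|gT|) := \matrix_(a, i) (enum_val i == e a)%:R.

Let repr_inj g h : g \in T -> (g^-1 * h)%g \in H -> repr (h *: H)%g = g.
Proof.
rewrite inE => /eqP {2}<- ghH; congr (repr _); apply: lcoset_eqP.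
by rewrite mem_lcoset.
Qed.

Let X'X : X' *m X = 1%:M.
Proof.
apply/matrixP => a b; rewrite !mxE (bigD1 (enum_rank (e a))) //= !mxE enum_rankK.
rewrite eqxx mul1r big1 ?addr0 => [|i ia]; last first.
  rewrite mxE; case: eqP => [ei|_]; last by rewrite mul0r.
  by rewrite -ei enum_valK eqxx in ia.
rewrite gr_coef_twist; case: (boolP (_ \in H)) => [abH|abH].
  have eb := enum_valP b; have ea := enum_valP a.
  have := repr_inj eb abH; rewrite inE in ea; rewrite (eqP ea) => /enum_val_inj ->.
  by rewrite mulVg twist_sign1 eqxx.
case: eqP => // ab; by rewrite ab mulVg group1 in abH.
Qed.

Let XXT : gr_rmx sH = X *m X^T.
Proof.
apply/matrixP => i j; rewrite !mxE.
set gi := enum_val i; set gj := enum_val j.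
under eq_bigr => a _ do rewrite !mxE.
rewrite -(big_enum_val (fun r => gr_coef sH (r^-1 * gi)%g * gr_coef sH (r^-1 * gj)%g)) /=.
set r := repr (gi *: H)%g.
have rH : (r^-1 * gi)%g \in H.
  have : r \in (gi *: H)%g by apply: mem_repr (lcoset_refl H gi).
  by rewrite mem_lcoset -groupV invMg invgK.
have rT : r \in T.
  by rewrite inE -(lcoset_eqP (_ : gi \in r *: H)%g) // mem_lcoset.
rewrite (bigD1 r) //= big1 ?addr0 => [|s /andP[sT sr]]; last first.
  rewrite gr_coef_twist; case: (boolP (_ \in H)) => [/(repr_inj sT) rs|_].
    by rewrite -rs eqxx in sr.
  by rewrite mul0r.
rewrite !gr_coef_twist rH mulr1n !intz.
have -> : (r^-1 * gj = (r^-1 * gi) * (gi^-1 * gj))%g by rewrite mulgA mulgK.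
rewrite (groupMl _ rH); case: (boolP (_ \in H)) => gH; last by rewrite mulr0.
by rewrite !mulr1n (lamM rH gH) mulrA lam2 // mul1r.
Qed.

(* The matrix A z below is the action of z on the left ideal generated by sH,
   whose elements are determined by their values at coset representatives. *)
Lemma coset_lattice_rank (F : groupRing int gT) (q : nat) : ~~ (3 %| q)%N ->
    F * F * F + F * F *+ (3 * q) + F *+ (3 * q ^ 2) = 0 ->
  lin (fun k => \sum_g gr_coef sH (k^-1 ^ g)%g) (F * F + F *+ (3 * q)) =
    - (#|H|%:Z * (6 * q%:Z ^+ 2)) *
    ((\rank (bar (gr_lmx F *m gr_rmx sH)))%:Z -
     (\rank (bar (gr_lmx (F * F) *m gr_rmx sH)))%:Z).
Proof.
move=> q3 F3; rewrite -mxtrace_lmx_rmx; set Y := X^T; set Y' := X'^T.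
have YY' : Y *m Y' = 1%:M by rewrite -trmx_mul X'X trmx1.
pose A z := X' *m gr_lmx z *m X.
have AY z : A z *m Y = Y *m gr_lmx z.
  rewrite /A -!mulmxA -XXT gr_lmx_rmxC XXT -!mulmxA.
  by rewrite (mulmxA X') X'X mul1mx.
have XA z : X *m A z = gr_lmx z *m X.
  by rewrite -[LHS]mulmx1 -YY' mulmxA -[X *m A z *m Y]mulmxA AY mulmxA -XXT
    -gr_lmx_rmxC XXT -!mulmxA YY' mulmx1.
have AE z : A z = Y *m gr_lmx z *m Y' by rewrite -AY -mulmxA YY' mulmx1.
have AM y z : A (y * z) = A z *m A y.
  by rewrite AE gr_lmxM mulmxA -AY -(mulmxA (A z)) -AY mulmxA -mulmxA YY' mulmx1.
have AD y z : A (y + z) = A y + A z by rewrite /A gr_lmxD mulmxDr mulmxDl.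
have AMn y n : A (y *+ n) = n%:Z *: A y.
  by rewrite /A gr_lmxMn natz -scalemxAr -scalemxAl.
have A0 : A 0 = 0.
  by rewrite -[0 in LHS](mulr0n (0 : groupRing int gT)) AMn scale0r.
have LR z : gr_lmx z *m gr_rmx sH = X *m A z *m Y by rewrite XXT mulmxA XA.
have rkA z : \rank (bar (gr_lmx z *m gr_rmx sH)) = \rank (bar (A z)).
  rewrite LR !map_mxM; apply: (@mxrank_inverse_sides _ _ _ _ _ (bar X') _ _ _ (bar Y')).
    by rewrite -map_mxM X'X map_mx1.
  by rewrite -map_mxM YY' map_mx1.
(* This comes from [sH * sH = sH *+ #|H|] after cancelling [X] and [Y]; it turns the trace on the
   group ring into [#|H|] times that on the lattice. *)
have YX : Y *m X = #|H|%:Z%:M.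
  have : X *m (Y *m X) *m Y = #|H|%:Z *: (X *m Y).
    rewrite !mulmxA -XXT -mulmxA -XXT -gr_rmxM sum_twistM.
    by apply/matrixP => i j; rewrite !mxE gr_coefMn -mulr_natl natz.
  move=> e1; have -> : Y *m X = X' *m (X *m (Y *m X) *m Y) *m Y'.
    by rewrite !mulmxA X'X mul1mx -mulmxA YY' mulmx1.
  rewrite e1 -scalemxAr -scalemxAl mulmxA X'X mul1mx YY'.
  by rewrite scalemx1.
rewrite LR -mulmxA mxtrace_mulC -mulmxA YX mul_mx_scalar mxtraceZ !rkA AD AMn AM.
have trA : \tr (A F *m A F + (3 * q%:Z) *: A F) = - (6 * q%:Z ^+ 2) *
    ((\rank (bar (A F)))%:Z - (\rank (bar (A F) *m bar (A F)))%:Z).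
  apply: int_trace_rank3; first by rewrite dvdzE.
  have := congr1 A F3; rewrite A0 !AD !AMn !AM !PoszM mulmxA => <-.
  by congr (_ + _ + _).
rewrite PoszM trA (map_mxM _ (A F) (A F)) !mulNr mulrN.
by congr (- _); apply: mulrA.
Qed.

End CosetLattice.

(** * Splitting a filtration modulo 3 *)

Section RankMod3.

Variable gT : finGroupType.
Local Notation K := (groupRing 'F_3 gT).
Implicit Types (x m f t F z : K).

Lemma gr_mulrn3 x n : (3 %| n)%N -> x *+ n = 0.
Proof.
move=> n3; apply: gr_coefP => g; rewrite gr_coefMn gr_coef0 -mulr_natl.
by move: n3; rewrite (dvdn_pcharf (pchar_Fp (isT : prime 3))) => /eqP ->; rewrite mul0r.
Qed.

(** A number prime to 3 is its own inverse modulo 3; divisions by [b] and [q] can thus be written as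
    multiplications. *)
Lemma gr_mulrn_sqr x n : ~~ (3 %| n)%N -> x *+ (n * n) = x.
Proof.
move=> n3; have [k ->] : exists k, (n * n = k * 3 + 1)%N.
  have : (n * n = 1 %[mod 3])%N.
    rewrite -modnMm; move: n3; rewrite /dvdn; have := ltn_pmod n (isT : 0 < 3)%N.
    by case: (n %% 3)%N => [|[|[|]]].
  by move=> h; exists (n * n %/ 3)%N; rewrite {1}(divn_eq (n * n) 3) h.
by rewrite mulrnDr gr_mulrn3 ?dvdn_mull // add0r.
Qed.

(** Rank and nullity of right multiplication by [y] on [F K z]: the hypotheses identify its kernel
    with [F K z']. *)
Lemma rank_lmx_rmx_cap F y z z' :
    (forall f m, f = F * m * z -> f * y = 0 -> exists m', f = F * m' * z') ->
    (forall m, exists m', m * z' = m' * z) -> z' * y = 0 ->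
  \rank (gr_lmx F *m gr_rmx z) =
    (\rank (gr_lmx F *m gr_rmx (z * y)%R) + \rank (gr_lmx F *m gr_rmx z'))%N.
Proof.
move=> fz z'z z'y; rewrite gr_rmxM mulmxA.
rewrite -(mxrank_mul_ker (gr_lmx F *m gr_rmx z) (gr_rmx y)); congr (_ + _)%N.
apply/eqP; rewrite eqn_leq; apply/andP; split; apply: mxrankS.
  apply/rV_subP => v; rewrite sub_capmx => /andP[/submxP[D ->]].
  have [m ->] := gr_vec_surj D.
  rewrite mulmxA gr_vec_lmx gr_vec_rmx => /sub_kermxP; rewrite gr_vec_rmx -gr_vec0.
  move/gr_vec_inj => /(fz _ m erefl)[m' ->]; rewrite -gr_vec_rmx -gr_vec_lmx -mulmxA.
  exact: submxMl.
apply/rV_subP => v /submxP[D ->]; have [m ->] := gr_vec_surj D.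
rewrite mulmxA gr_vec_lmx gr_vec_rmx -mulrA; have [m' m'E] := z'z m.
rewrite sub_capmx; apply/andP; split.
  by rewrite m'E mulrA -gr_vec_rmx -gr_vec_lmx -mulmxA submxMl.
by apply/sub_kermxP; rewrite gr_vec_rmx -!mulrA z'y !mulr0 gr_vec0.
Qed.

Variables (y sP sB sS sG rho : K) (b : nat).
Local Notation sN := (sP * sB)%R.
Local Notation sC := (sP * sS)%R.
Hypotheses (b3 : ~~ (3 %| b)%N) (yy : y * y = sP) (sPy : sP * y = 0)
  (sBy : sB * y = y * sS) (sSy : sS * y = y * sB)
  (sBB : sB * sB = sB *+ b) (sSS : sS * sS = sS *+ b)
  (kery : forall m, m * y = 0 -> exists m', m = m' * sP)
  (rhoP : sN * rho * sN = (sG - sN) *+ b).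

(* Right multiplication by y maps K sB onto K sB y with kernel K sN, and K sB y
   onto K sN with kernel K sC. On the image of E both extensions are split by
   right multiplication by rho, because E kills the multiples of sG. *)
Lemma rank_mod3_identity F E q : ~~ (3 %| q)%N ->
    E * F = F *+ q -> F * E = F *+ q -> (forall x, E * x * sG = 0) ->
  \rank (gr_lmx F *m gr_rmx sB) =
    (2 * \rank (gr_lmx F *m gr_rmx sN) + \rank (gr_lmx F *m gr_rmx sC))%N.
Proof.
move=> q3 EF FE EG; have bq3 : ~~ (3 %| b * q)%N by rewrite Euclid_dvdM ?negb_or ?b3.
have sBP : sB * sP = sN by rewrite -yy mulrA sBy -mulrA sSy mulrA.
have step1 := @rank_lmx_rmx_cap F y sB sN.
rewrite {}step1; first last.
- by rewrite -mulrA sBy mulrA sPy mul0r.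
- by move=> m; exists (m * sP); rewrite mulrA.
- move=> f m fE fy; have [f' f'E] := kery fy.
  have fB' : f * sB = f *+ b by rewrite fE -[LHS]mulrA sBB mulrnAr.
  have fB : f *+ b = f' * sN by rewrite -fB' {1}f'E -mulrA.
  have Ef : E * f = f *+ q by rewrite fE !mulrA EF !mulrnAl.
  (* As [f *+ b = f' * sN], [rhoP] yields a multiple of [sG - sN]; [E] kills the part with [sG] and
     leaves a multiple of [f]. *)
  have h1 : E * (f *+ b * rho * sN) = - f *+ (q * b * b).
    rewrite fB -!mulrA [sP * (sB * _)]mulrA [sN * (rho * _)]mulrA rhoP.
    rewrite mulrnAr mulrBr -fB mulrnAr mulrBr [E * (f' * sG)]mulrA EG sub0r.
    by rewrite mulrnAr Ef !mulNrn -!mulrnA mulnA.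
  have h2 : E * (f *+ b * rho * sN) = F * (m * sB * rho) * sN *+ (q * b).
    by rewrite !mulrnAl mulrnAr !mulrA Ef !mulrnAl -mulrnA fE.
  (* The factor [q * b] of [h2] is multiplied by the factor [q * b * b] of [h1], so that the latter
     appears squared on [f]. *)
  exists (- (m * sB * rho) *+ (q * b * (q * b * b))).
  have qbb3 : ~~ (3 %| q * b * b)%N by rewrite !Euclid_dvdM ?negb_or ?b3 ?q3.
  rewrite mulrnAr mulrnAl mulrN mulNr mulrnA mulNrn -h2 h1.
  rewrite [(- f) *+ _]mulNrn opprK -mulrnA.
  by rewrite gr_mulrn_sqr.
rewrite (@rank_lmx_rmx_cap F y (sB * y) sC); first last.
- by rewrite -mulrA sSy mulrA sPy mul0r.
- by move=> m; exists (m * y); rewrite -yy -[y * y * sS]mulrA -sBy -!mulrA.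
- move=> f m fE fy.
  (* The term with [rho] turns [t * y] into a multiple of [sG], so [E * t] is killed by [y]. It does
     not affect [F * t], because [f * y = 0]. *)
  pose t := m * (sB * y) *+ b + m * sN * rho * (sB * y).
  have ty : t * y = m * sG *+ b.
    rewrite /t mulrDl mulrnAl -!mulrA yy sBP [sP * (sB * (rho * _))]mulrA.
    rewrite [sN * (rho * _)]mulrA rhoP.
    by rewrite mulrnAr -mulrnDl mulrBr addrC subrK.
  have [t' t'E] : exists t', E * t = t' * sP.
    by apply: kery; rewrite -mulrA ty mulrnAr mulrA EG mul0rn.
  have tS : t * sS = t *+ b.
    have yS : sB * y * sS = (sB * y) *+ b.
      by rewrite sBy -mulrA sSS mulrnAr.
    by rewrite /t mulrDl mulrnAl -!mulrA [sB * _]mulrA yS !mulrnAr mulrnDl.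
  have Ft : F * t = f *+ b.
    rewrite /t mulrDr mulrnAr mulrA -fE -sBP -yy.
    have -> : F * (m * (sB * (y * y)) * rho * (sB * y)) = f * y * rho * (sB * y).
      by rewrite fE !mulrA.
    by rewrite fy !mul0r addr0.
  exists (t' *+ (b * b * q)).
  have -> : F * (t' *+ (b * b * q)) * sC = F * (t' * sP * sS) *+ (b * b * q).
    by rewrite mulrnAr mulrnAl !mulrA.
  rewrite -t'E -mulrA tS !mulrnAr mulrA FE mulrnAl Ft -!mulrnA.
  have -> : (b * (q * (b * (b * b * q))) = b * b * q * (b * b * q))%N by lia.
  by rewrite gr_mulrn_sqr // !Euclid_dvdM ?negb_or ?b3 ?q3.
by rewrite -mulrA yy sBP; lia.
Qed.

End RankMod3.

(** * Reduction of the group ring modulo 3 *)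

Section GroupRingMap.
Variable gT : finGroupType.
Implicit Types x y : groupRing int gT.
Local Notation bar := (map_mx (intr : int -> 'F_3)).

Definition gr_mod3 x : groupRing 'F_3 gT := [ffun g => (gr_coef x g)%:~R].

Lemma gr_coef_mod3 x g : gr_coef (gr_mod3 x) g = (gr_coef x g)%:~R.
Proof. by rewrite {1}/gr_coef ffunE. Qed.

Lemma gr_mod3D x y : gr_mod3 (x + y) = gr_mod3 x + gr_mod3 y.
Proof. by apply: gr_coefP => g; rewrite gr_coefD !gr_coef_mod3 gr_coefD rmorphD. Qed.

Lemma gr_mod3_0 : gr_mod3 0 = 0.
Proof. by apply: gr_coefP => g; rewrite gr_coef_mod3 !gr_coef0. Qed.

Lemma gr_mod3N x : gr_mod3 (- x) = - gr_mod3 x.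
Proof. by apply: (addrI (gr_mod3 x)); rewrite -gr_mod3D !subrr gr_mod3_0. Qed.

Lemma gr_mod3M x y : gr_mod3 (x * y) = gr_mod3 x * gr_mod3 y.
Proof.
apply: gr_coefP => g; rewrite gr_coef_mul gr_coef_mod3 gr_coef_mul rmorph_sum.
by apply: eq_bigr => h _; rewrite !gr_coef_mod3 rmorphM.
Qed.

Lemma gr_mod3Mn x n : gr_mod3 (x *+ n) = gr_mod3 x *+ n.
Proof. by elim: n => [|n IH]; rewrite ?mulr0n ?gr_mod3_0 // !mulrS gr_mod3D IH. Qed.

Lemma gr_mod3_twist (H : {set gT}) lam :
  gr_mod3 (sum_twist int H lam) = sum_twist 'F_3 H lam.
Proof.
by apply: gr_coefP => g; rewrite gr_coef_mod3 !gr_coef_twist intz rmorphMn.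
Qed.

Lemma gr_mod3_delta g : gr_mod3 (gr_delta g) = gr_delta g.
Proof. by apply: gr_coefP => h; rewrite gr_coef_mod3 !gr_coef_delta natz; case: eqP. Qed.

Lemma map_lmx_mod3 x : bar (gr_lmx x) = gr_lmx (gr_mod3 x).
Proof. by apply/matrixP => i j; rewrite !mxE gr_coef_mod3. Qed.

Lemma map_rmx_mod3 x : bar (gr_rmx x) = gr_rmx (gr_mod3 x).
Proof. by apply/matrixP => i j; rewrite !mxE gr_coef_mod3. Qed.

End GroupRingMap.

(** * The normalizer of a Sylow subgroup of order 3 *)

(** The Sylow subgroup has order 3 and is a normal Hall subgroup of its normalizer, so
    Schur-Zassenhaus provides [B]. *)
Lemma sylow3_complement (gT : finGroupType) : (3 %| #|gT|)%N -> ~~ (9 %| #|gT|)%N ->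
  exists (c : gT) (B : {group gT}),
    [/\ #[c]%g = 3%N, (3.-Sylow([set: gT]) <[c]>)%g, (<[c]> * B)%g = 'N(<[c]>)%g &
        (<[c]> :&: B)%g = 1%g].
Proof.
move=> d3 d9; have [P sylP] := Sylow_exists 3 [set: gT].
have oP : #|P| = 3%N.
  rewrite (card_Hall sylP) p_part cardsT.
  suff -> : logn 3 #|gT| = 1%N by [].
  have G0 : (0 < #|gT|)%N by rewrite -cardsT cardG_gt0.
  apply/eqP; rewrite eqn_leq -ltnS ltnNge -!pfactor_dvdn //.
  by rewrite d9 d3.
have cycP : cyclic P by apply: prime_cyclic; rewrite oP.
have [c Pc] := cyclicP cycP.
have oc : #[c]%g = 3%N by rewrite orderE -Pc.
have hallP : Hall 'N(P)%g P.
  by apply: pHall_Hall (pHall_subl _ (subsetT _) sylP); apply: normG.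
have nP : (P <| 'N(P))%g by apply: normalG.
have /splitsP[B /complP[tiPB PB]] := SchurZassenhaus_split hallP nP.
by exists c, B; rewrite -Pc.
Qed.

Section Local.

Variables (gT : finGroupType) (c : gT) (B : {group gT}).
Local Notation P := <[c]>%g.
Local Notation N := 'N(<[c]>)%g.
Hypotheses (oc : #[c]%g = 3%N) (sylP : (3.-Sylow([set: gT]) P)%g)
  (PB : (P * B)%g = N) (tiPB : (P :&: B)%g = 1%g).

Definition inv_sign g : int := if (c ^ g == c)%g then 1 else - 1.

Lemma generator_expg3 : (c ^+ 3 = 1)%g. Proof. by rewrite -oc expg_order. Qed.

Lemma sqr_generator : (c * c = c^-1)%g.
Proof. by apply: (mulIg c); rewrite mulVg -generator_expg3 !expgS expg0 mulg1 !mulgA. Qed.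

Lemma sqr_generatorV : (c^-1 * c^-1 = c)%g.
Proof. by rewrite -invMg sqr_generator invgK. Qed.

Lemma generator_neq1 : (c != 1)%g. Proof. by rewrite -order_eq1 oc. Qed.

Lemma generatorV_neq1 : (c^-1 != 1)%g. Proof. by rewrite invg_eq1 generator_neq1. Qed.

Lemma generatorV_neq : (c^-1 != c)%g.
Proof.
apply: contra generator_neq1 => /eqP cV; rewrite -sqr_generator in cV.
by apply/eqP/(mulgI c); rewrite mulg1.
Qed.

Lemma mem_sylow3 g : (g \in P) = [|| g == 1, g == c | g == c^-1]%g.
Proof.
apply/idP/or3P => [/cyclePmin[i]|[]/eqP->]; rewrite ?group1 ?groupV ?cycle_id //.
rewrite oc; case: i => [|[|[|//]]] _ ->;
  rewrite ?expg0 ?expg1 ?expgS ?expg0 ?mulg1 ?sqr_generator ?eqxx.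
- by constructor.
- by constructor.
- by constructor.
Qed.

Lemma inv_sign_cases g : g \in N ->
  ((c ^ g)%g = c /\ inv_sign g = 1) \/ ((c ^ g)%g = c^-1%g /\ inv_sign g = - 1).
Proof.
move=> gN; have : (c ^ g)%g \in P by rewrite memJ_norm ?cycle_id.
rewrite mem_sylow3 /inv_sign conjg_eq1 (negPf generator_neq1) /= => /orP[]/eqP ->.
  by left; rewrite eqxx.
by right; rewrite (negPf generatorV_neq).
Qed.

Lemma inv_signM : {in N &, forall g h, inv_sign (g * h)%g = inv_sign g * inv_sign h}.
Proof.
move=> g h gN hN; rewrite {1}/inv_sign conjgM.
case: (inv_sign_cases gN) => -[-> ->]; case: (inv_sign_cases hN) => -[ch ->].
- by rewrite ch eqxx.
- by rewrite ch (negPf generatorV_neq) mul1r.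
- by rewrite conjVg ch (negPf generatorV_neq) mulr1.
- by rewrite conjVg ch invgK eqxx mulrNN mulr1.
Qed.

Lemma inv_sign2 : {in N, forall g, inv_sign g * inv_sign g = 1}.
Proof. by move=> g /inv_sign_cases[] [_ ->]; rewrite ?mulrNN mulr1. Qed.

Lemma inv_sign_sylow3 : {in P, forall g, inv_sign g = 1}.
Proof.
move=> g gP; rewrite /inv_sign.
have /cycleP[i ->] := gP.
by rewrite conjgE -expgS expgSr mulKg eqxx.
Qed.

Lemma complement_sub_norm : B \subset N. Proof. by rewrite -PB mulG_subr. Qed.
Lemma sylow3_sub_norm : P \subset N. Proof. exact: normG. Qed.

Lemma card_norm_sylow3 : #|N| = (3 * #|B|)%N.
Proof. by rewrite -PB TI_cardMg // -orderE oc. Qed.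

Lemma mem_sylow3_order3 z : z \in N -> #[z]%g = 3%N -> z \in P.
Proof.
move=> zN oz; have hP := pHall_subl sylow3_sub_norm (subsetT _) sylP.
by rewrite (mem_normal_Hall hP (normalG _) zN) /p_elt oz.
Qed.

Lemma three_ndvd_complement : ~~ (3 %| #|B|)%N.
Proof.
apply/negP => /Cauchy[] // z zB oz.
have zP := mem_sylow3_order3 (subsetP complement_sub_norm _ zB) oz.
have : z \in P :&: B by rewrite inE zP.
by rewrite tiPB => /set1P z1; rewrite z1 order1 in oz.
Qed.

(** Otherwise [z] generates [P], and its conjugate by [g^-1] has order 3 in [N], hence lies in [P];
    then [g] normalizes [P]. *)
Lemma sylow3_cap_conj_norm g z : g \notin N -> z \in P -> z \in (N :^ g)%g -> z = 1%g.
Proof.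
move=> gN zP; rewrite mem_conjg => zN; apply/eqP; apply: contraR gN => z1.
have oz : #[z]%g = 3%N.
  have : (#[z]%g %| 3)%N by rewrite -oc; apply: order_dvdG zP.
  by move/prime_nt_dvdP => -> //; rewrite order_eq1.
have Pz : <[z]>%g = P.
  by apply/eqP; rewrite eqEcard cycle_subG zP /= -!orderE oz oc.
have zgP : (z ^ g^-1)%g \in P by apply: mem_sylow3_order3; rewrite ?orderJ.
rewrite -groupV; apply/normP; rewrite -{1}Pz -cycleJ.
by apply/eqP; rewrite eqEcard cycle_subG zgP /= -!orderE orderJ oz oc.
Qed.

(** * Relations among the sums over P, B and N *)

Local Notation one := (fun=> 1 : int).
Local Notation sP := (sum_twist int P one).
Local Notation sB := (sum_twist int B one).
Local Notation sS := (sum_twist int B inv_sign).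
Local Notation sN := (sum_twist int N one).
Local Notation sC := (sum_twist int N inv_sign).
Local Notation sG := (sum_twist int [set: gT] one).
Local Notation y := (gr_delta c - gr_delta c^-1%g : groupRing int gT).

Lemma sum_twist_prod lam : {in P & B, forall p b, lam (p * b)%g = lam b} ->
  sP * sum_twist int B lam = sum_twist int N lam.
Proof.
move=> lamPB; apply: gr_coefP => g; rewrite gr_coef_mul !gr_coef_twist.
have coefE h : gr_coef sP h * gr_coef (sum_twist int B lam) (h^-1 * g)%g =
    ((lam g)%:~R *+ (g \in N)) *+ ((h \in P) && ((h^-1 * g)%g \in B)).
  rewrite !gr_coef_twist; case: (boolP (h \in P)) => hP; last by rewrite mul0r.
  case: (boolP (_ \in B)) => hB /=; last by rewrite mulr0.
  have gE : g = (h * (h^-1 * g))%g by rewrite mulKVg.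
  have gN : g \in N by rewrite gE -PB mem_mulg.
  have lamE : lam g = lam (h^-1 * g)%g by rewrite {1}gE lamPB.
  by rewrite gN lamE !mulr1n mul1r.
rewrite (eq_bigr _ (fun h _ => coefE h)); case: (boolP (g \in N)) => gN; last first.
  by rewrite big1 // => h _; rewrite mulr0n mul0rn.
have := gN; rewrite -PB => /mulsgP[p b pP bB gE].
rewrite (bigD1 p) //= pP gE mulKg bB /= mulr1n big1 ?addr0 // => h hp.
rewrite mulr1n; case: (boolP (h \in P)) => hP //=.
case: (boolP (_ \in B)) => hB //=; case/eqP: hp.
have : (h^-1 * p)%g \in P :&: B.
  by rewrite inE groupM ?groupV //= -(groupMr _ bB) -mulgA.
by rewrite tiPB => /set1P/eqP; rewrite -eq_invg_mul invgK => /eqP.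
Qed.

Lemma sum_sylow3_mul_complement : sP * sB = sN. Proof. exact: sum_twist_prod. Qed.

Lemma sum_sylow3_mul_signed : sP * sS = sC.
Proof.
apply: sum_twist_prod => p b pP bB.
have pN := subsetP sylow3_sub_norm _ pP; have bN := subsetP complement_sub_norm _ bB.
by rewrite (inv_signM pN bN) inv_sign_sylow3 ?mul1r.
Qed.

Lemma sum_sylow3_mul_diff : sP * y = 0.
Proof.
apply/eqP; rewrite mulrBr subr_eq0; apply/eqP/gr_coefP => g.
rewrite !gr_coef_deltaMr !gr_coef_twist.
by rewrite !groupMr ?groupV ?cycle_id.
Qed.

(** Since [c ^ 3 = 1], the square is [c^-1 + c - 2]. Modulo 3, [y] is thus a square root of [sP],
    and multiplying by it gives the steps of the filtration. *)
Lemma sqr_diff : y * y = sP - 3%:R.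
Proof.
apply: gr_coefP => g; rewrite mulrBl !mulrBr !gr_deltaM sqr_generator mulgV mulVg sqr_generatorV.
rewrite !(gr_coefD, gr_coefN) !gr_coef_delta gr_coef_twist mem_sylow3.
case: (altP (g =P 1%g)) => [->|g1].
  by rewrite eq_sym (negPf generatorV_neq1) eq_sym (negPf generator_neq1).
by case: (altP (g =P c)) => [->|gc]; rewrite ?[_ == c^-1%g]eq_sym ?(negPf generatorV_neq) //;
  case: eqP.
Qed.

Lemma sum_twistE (H : {set gT}) lam :
  sum_twist int H lam = \sum_(h in H) gr_delta h *~ lam h.
Proof.
apply: gr_coefP => g; rewrite gr_coef_twist gr_coef_sum intz.
have coefZ h : gr_coef (gr_delta h *~ lam h : groupRing int gT) g = (g == h)%:R * lam h.
  rewrite -[lam h in RHS]intz mulrzr; case: (lam h) => n; rewrite ?NegzE ?mulrNz -?pmulrn ?gr_coefN;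
    by rewrite gr_coefMn gr_coef_delta.
rewrite (eq_bigr _ (fun h _ => coefZ h)); case: (boolP (g \in H)) => gH.
  rewrite (bigD1 g) //= eqxx mul1r big1 ?addr0 // => h /andP[_ /negPf hg].
  by rewrite eq_sym hg mul0r.
rewrite big1 // => h hH; rewrite (_ : (g == h) = false) ?mul0r //.
by apply: contraNF gH => /eqP ->.
Qed.

Lemma delta_mul_diff b : b \in N -> gr_delta b * y = y * gr_delta b *~ inv_sign b.
Proof.
move=> bN; have cbE z : (b * z = z ^ b^-1 * b)%g by rewrite conjgE invgK !mulgA mulgKV.
rewrite mulrBr !mulrBl !gr_deltaM !cbE conjVg.
have bVN : b^-1%g \in N by rewrite groupV.
have sV : inv_sign b^-1%g = inv_sign b.
  have := inv_signM bN bVN; rewrite mulgV (inv_sign_sylow3 (group1 _)) => e1.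
  by rewrite -[LHS]mul1r -(inv_sign2 bN) -mulrA -e1 mulr1.
rewrite -sV; case: (inv_sign_cases bVN) => -[-> ->]; first by rewrite mulr1z.
by rewrite invgK mulrN1z opprB.
Qed.

Lemma twist_mul_diff lam lam' : {in B, forall b, lam b * inv_sign b = lam' b} ->
  sum_twist int B lam * y = y * sum_twist int B lam'.
Proof.
move=> lamE; rewrite !sum_twistE mulr_suml mulr_sumr; apply: eq_bigr => b bB.
rewrite mulrzAl delta_mul_diff ?(subsetP complement_sub_norm) // -lamE // mulrzA !mulrzAr.
by rewrite -!mulrzA mulrC.
Qed.

Lemma sum_complement_mul_diff : sB * y = y * sS.
Proof. by apply: twist_mul_diff => b _; rewrite mul1r. Qed.

Lemma signed_sum_mul_diff : sS * y = y * sB.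
Proof. by apply: twist_mul_diff => b bB; rewrite inv_sign2 ?(subsetP complement_sub_norm). Qed.

Lemma sqr_sum_complement : sB * sB = sB *+ #|B|.
Proof. exact: sum_twistM. Qed.

Lemma sqr_signed_sum : sS * sS = sS *+ #|B|.
Proof.
by apply: sum_twistM => g h gB hB; rewrite inv_signM ?(subsetP complement_sub_norm).
Qed.

Lemma sum_twist_mul_setT (H : {set gT}) : sum_twist int H one * sG = sG *+ #|H|.
Proof.
apply: gr_coefP => g; rewrite gr_coef_mul gr_coefMn !gr_coef_twist inE mulr1n.
under eq_bigr => h _ do rewrite !gr_coef_twist inE mulr1.
by rewrite -sumr_const [RHS]big_mkcond; apply: eq_bigr => h _; case: (h \in H).
Qed.

(** * Double cosets of P and N *)

Definition double_coset g : {set gT} := (P * [set g] * N)%g.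

(* One representative for each double coset of P and N other than N. *)
Definition double_coset_sum : groupRing int gT :=
  [ffun t => ((t \notin N) && (repr (double_coset t) == t))%:R].

Lemma double_cosetP t g :
  reflect (exists p n, [/\ p \in P, n \in N & t = p * g * n]%g) (t \in double_coset g).
Proof.
apply: (iffP idP) => [|[p [n [pP nN ->]]]].
  by case/mulsgP => _ n /mulsgP[p _ pP /set1P->] -> nN ->; exists p, n.
by rewrite !mem_mulg ?set11.
Qed.

Lemma double_coset_id g : g \in double_coset g.
Proof. by apply/double_cosetP; exists 1%g, 1%g; rewrite !group1 mulg1 mul1g. Qed.

Lemma double_coset_eq t g : t \in double_coset g -> double_coset t = double_coset g.
Proof.
move=> /double_cosetP[p [n [pP nN ->]]]; apply/setP => x.
apply/double_cosetP/double_cosetP => -[p' [n' [pP' nN' ->]]].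
  by exists (p' * p)%g, (n * n')%g; rewrite !groupM // !mulgA.
exists (p' * p^-1)%g, (n^-1 * n')%g; rewrite !groupM ?groupV //; split=> //.
by rewrite !mulgA !mulgKV mulgK.
Qed.

(** For [t] outside [N], [P] meets the conjugates of [N] by [t] and its inverse trivially, so each
    element of [P t N] is [p t n] in only one way. *)
Lemma sylow3_double_coset_sum_norm : sP * double_coset_sum * sN = sG - sN.
Proof.
apply: gr_coefP => g; rewrite gr_coefD gr_coefN gr_coef_mul_r !gr_coef_twist inE mulr1n.
have coefE n : gr_coef (sP * double_coset_sum) (g * n^-1)%g * gr_coef sN n =
   \sum_p ([&& n \in N, p \in P & p^-1 * (g * n^-1) \notin N]%g &&
    (repr (double_coset g) == p^-1 * (g * n^-1))%g)%:R.
  rewrite gr_coef_mul mulr_suml; apply: eq_bigr => p _.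
  rewrite !gr_coef_twist /gr_coef ffunE; case: (boolP (n \in N)) => nN; last by rewrite mulr0.
  case: (boolP (p \in P)) => pP; last by rewrite !mul0r.
  rewrite mulr1 mul1r /= (@double_coset_eq (p^-1 * (g * n^-1))%g g) //.
  by apply/double_cosetP; exists p^-1%g, n^-1%g; rewrite !groupV mulgA.
rewrite (eq_bigr _ (fun n _ => coefE n)); case: (boolP (g \in N)) => gN.
  rewrite subrr big1 // => n _; rewrite big1 // => p _.
  case: (boolP (n \in N)) => nN //; case: (boolP (p \in P)) => pP //=.
  by rewrite !groupM ?groupV // (subsetP sylow3_sub_norm).
have /double_cosetP[p0 [n0 [pP0 nN0 t0E]]] := mem_repr g (double_coset_id g).
have tE n p : [&& n \in N, p \in P & p^-1 * (g * n^-1) \notin N]%g &&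
    (repr (double_coset g) == p^-1 * (g * n^-1))%g = (n == n0^-1)%g && (p == p0^-1)%g.
  apply/idP/andP => [/andP[/and3P[nN pP _] /eqP e]|[/eqP-> /eqP->]]; last first.
    rewrite !groupV nN0 pP0 !invgK mulgA t0E eqxx andbT /=.
    by rewrite groupMr // groupMl // (subsetP sylow3_sub_norm).
  have e0 : (p * p0 * g = g * (n^-1 * n0^-1))%g.
    apply: (mulIg n0); rewrite -[RHS]mulgA mulgKV.
    have <- : (p * (p0 * g * n0) = g * n^-1)%g by rewrite -t0E e mulKVg.
    by rewrite !mulgA.
  have e1 : (p * p0 = 1)%g.
    apply: (@sylow3_cap_conj_norm g^-1%g); [by rewrite groupV | exact: groupM |].
    by rewrite mem_conjg invgK conjgE e0 mulKg groupM // groupV.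
  have e2 : (n^-1 * n0^-1 = 1)%g.
    by apply: (mulgI g); rewrite -e0 e1 mul1g mulg1.
  split; apply/eqP.
    by rewrite -(mulg1_eq e2) invgK.
  by rewrite -(mulg1_eq e1) invgK.
under eq_bigr => n _ do under eq_bigr => p _ do rewrite tE.
rewrite (bigD1 n0^-1%g) //= (bigD1 p0^-1%g) //= !eqxx subr0 !big1 ?addr0 //.
  by move=> n /negPf ->; rewrite big1.
by move=> p /negPf ->; rewrite andbF.
Qed.

Lemma sum_complement_mul_sylow3 : sB * sP = sN.
Proof.
have sPE : sP = y * y + 3%:R by rewrite sqr_diff subrK.
rewrite -sum_sylow3_mul_complement sPE [LHS]mulrDr [RHS]mulrDl mulr_natl mulr_natr; congr (_ + _).
by rewrite mulrA sum_complement_mul_diff -mulrA signed_sum_mul_diff mulrA.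
Qed.

Lemma norm_double_coset_sum_norm : sN * double_coset_sum * sN = (sG - sN) *+ #|B|.
Proof.
rewrite -{1}sum_complement_mul_sylow3 -!mulrA [sP * _]mulrA sylow3_double_coset_sum_norm mulrBr mulrnBl.
by rewrite sum_twist_mul_setT -sum_complement_mul_sylow3 mulrA sqr_sum_complement mulrnAl.
Qed.

(** [m * c = m * c^-1] makes [m] constant on the left cosets of [P]; [m'] keeps its values at one
    representative of each. *)
Lemma mod3_ker_diff (m : groupRing 'F_3 gT) :
  m * gr_mod3 y = 0 -> exists m', m = m' * gr_mod3 sP.
Proof.
rewrite gr_mod3D gr_mod3N !gr_mod3_delta mulrBr => /subr0_eq my.
have mc g : gr_coef m (g * c)%g = gr_coef m g.
  have := congr1 (fun x => gr_coef x (g * c^-1)%g) my.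
  rewrite !gr_coef_deltaMr invgK -[(g * c^-1 * c^-1)%g]mulgA sqr_generatorV mulgKV => <-.
  by [].
have mP g p : p \in P -> gr_coef m (g * p)%g = gr_coef m g.
  case/cycleP => i ->; elim: i => [|i IH]; first by rewrite expg0 mulg1.
  by rewrite expgSr mulgA mc.
pose m' : groupRing 'F_3 gT := [ffun g => if repr (g *: P)%g == g then gr_coef m g else 0].
have m'E g : gr_coef m' g = if repr (g *: P)%g == g then gr_coef m g else 0.
  by rewrite {1}/gr_coef ffunE.
exists m'.
apply: gr_coefP => g; rewrite gr_coef_mul gr_mod3_twist.
set r := repr (g *: P)%g.
have rg : r \in (g *: P)%g by apply: mem_repr (lcoset_refl _ _).
have gr : (r^-1 * g)%g \in P.
  by move: rg; rewrite mem_lcoset -groupV invMg invgK.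
rewrite (bigD1 r) //= big1 ?addr0 => [|h hr]; last first.
  rewrite gr_coef_twist; case: (boolP (_ \in P)) => hP; last by rewrite mulr0.
  rewrite m'E; case: eqP => hh; last by rewrite mul0r.
  case/eqP: hr; rewrite -hh /r; congr (repr _); apply/esym/lcoset_eqP.
  by rewrite mem_lcoset.
rewrite gr_coef_twist gr m'E.
have -> : (r *: P = g *: P)%g by apply/esym/lcoset_eqP; rewrite mem_lcoset.
by rewrite eqxx mulr1n mulr1 -{1}(mulKVg r g) mP.
Qed.

(** * Counting conjugates in B and N *)

Lemma inv_sign_conj n p : n \in N -> p \in P -> inv_sign (n ^ p)%g = inv_sign n.
Proof.
move=> nN pP; have pN := subsetP sylow3_sub_norm _ pP.
have pVP : p^-1%g \in P by rewrite groupV.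
have pVN := subsetP sylow3_sub_norm _ pVP.
rewrite conjgE (inv_signM pVN (groupM nN pN)) (inv_signM nN pN) (inv_sign_sylow3 pVP).
by rewrite (inv_sign_sylow3 pP) mulr1 mul1r.
Qed.

(** A power of [n] of order 3 generates [P], and [n] commutes with it. *)
Lemma inv_sign_singular n : n \in N -> (3 %| #[n]%g)%N -> inv_sign n = 1.
Proof.
move=> nN n3; pose z := (n ^+ (#[n]%g %/ 3))%g.
have oz : #[z]%g = 3%N.
  by rewrite orderXdiv ?dvdn_div // divnA // mulKn.
have zP : z \in P by apply: mem_sylow3_order3; rewrite ?groupX.
have Pz : <[z]>%g = P.
  by apply/eqP; rewrite eqEcard cycle_subG zP /= -!orderE oz oc.
have : c \in <[z]>%g by rewrite Pz cycle_id.
case/cycleP => i ci; rewrite /inv_sign ci conjXg.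
have -> : (z ^ n = z)%g by rewrite /z conjXg conjgE mulKg.
by rewrite eqxx.
Qed.

Lemma inv_signV n : n \in N -> inv_sign n^-1%g = inv_sign n.
Proof.
move=> nN; have nVN : n^-1%g \in N by rewrite groupV.
have := inv_signM nN nVN; rewrite mulgV (inv_sign_sylow3 (group1 _)) => e1.
by rewrite -[LHS]mul1r -(inv_sign2 nN) -mulrA -e1 mulr1.
Qed.

Lemma conj_sylow3 n p : n \in N -> p \in P ->
  (p ^ n)%g = if inv_sign n == 1 then p else p^-1%g.
Proof.
move=> nN /cycleP[i ->]; rewrite conjXg.
by case: (inv_sign_cases nN) => -[-> ->] //=; rewrite expgVn.
Qed.

Lemma order_sylow3 p : p \in P -> (p != 1)%g -> #[p]%g = 3%N.
Proof.
move=> pP p1; have : (#[p]%g %| 3)%N by rewrite -oc; apply: order_dvdG pP.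
by move/prime_nt_dvdP => -> //; rewrite order_eq1.
Qed.

Lemma sqr_sylow3 p : p \in P -> (p * p = p^-1)%g.
Proof.
rewrite mem_sylow3 => /or3P[]/eqP->; first by rewrite mulg1 invg1.
  exact: sqr_generator.
by rewrite sqr_generatorV invgK.
Qed.

(** Write [n = a b] with [a] in [P]. If [n] centralizes [P], all three conjugates lie in [B] or
    none, according as [a = 1] or not; if it inverts [P], exactly one does. *)
Lemma count_conj_in_B n : n \in N ->
  \sum_(p in P) ((n ^ p)%g \in B)%:R = 2 + inv_sign n - 3 * (3 %| #[n]%g)%:R :> int.
Proof.
move=> nN; have := nN; rewrite -PB => /mulsgP[a b aP bB nE].
have bN := subsetP complement_sub_norm _ bB; have bVN : b^-1%g \in N by rewrite groupV.
have sE : inv_sign n = inv_sign b.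
  by rewrite nE (inv_signM (subsetP sylow3_sub_norm _ aP) bN) inv_sign_sylow3 // mul1r.
have memE p : p \in P -> ((n ^ p)%g \in B) = (p^-1 * a * p ^ b^-1 == 1)%g.
  move=> pP; have -> : (n ^ p = (p^-1 * a * p ^ b^-1) * b)%g.
    by rewrite nE !conjgE invgK !mulgA mulgKV.
  rewrite groupMr //; apply/idP/eqP => [h|->]; last exact: group1.
  have pbP : (p ^ b^-1)%g \in P by rewrite memJ_norm.
  apply/set1gP; rewrite -tiPB inE h andbT.
  by rewrite (groupM (groupM (groupVr pP) aP) pbP).
rewrite (eq_bigr _ (fun p pP => congr1 (fun x : bool => x%:R) (memE p pP))).
have sbV : inv_sign b^-1%g = inv_sign n by rewrite inv_signV.
case: (inv_sign_cases nN) => -[_ sn].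
  have condE p : p \in P -> (p^-1 * a * p ^ b^-1 == 1)%g = (a == 1)%g.
    move=> pP; rewrite (conj_sylow3 bVN pP) sbV sn eqxx -mulgA -conjgE.
    by rewrite conjg_eq1.
  rewrite (eq_bigr _ (fun p pP => congr1 (fun x : bool => x%:R) (condE p pP))).
  rewrite sumr_const -orderE oc sn; have [a1|a1] := eqVneq a 1%g.
    rewrite (_ : (3 %| #[n]%g)%N = false) //; apply: contraNF three_ndvd_complement => /dvdn_trans; apply.
    by rewrite nE a1 mul1g order_dvdG.
  rewrite (_ : (3 %| #[n]%g)%N) //; set k := #[n]%g.
  have cab : commute a b.
    apply/commgP/conjg_fixP; rewrite (conj_sylow3 bN aP) -sE sn eqxx //.
  have akbk : (a ^+ k * b ^+ k = 1)%g by rewrite -expgMn // -nE expg_order.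
  rewrite -(order_sylow3 aP a1) order_dvdn; apply/eqP/set1gP; rewrite -tiPB inE groupX //=.
  by rewrite -groupV (mulg1_eq akbk) groupX.
have n3 : (3 %| #[n]%g)%N = false.
  by apply/negP => /(inv_sign_singular nN); rewrite sn.
have condE p : p \in P -> (p^-1 * a * p ^ b^-1 == 1)%g = (p == a^-1)%g.
  move=> pP; rewrite (conj_sylow3 bVN pP) sbV sn /=.
  apply/eqP/eqP => [h|->]; last by rewrite !invgK sqr_sylow3 // mulVg.
  have -> : a = (p * p)%g by rewrite -{1}(mulg1 p) -h !mulgA mulgV mul1g mulgKV.
  by rewrite sqr_sylow3 // invgK.
rewrite (eq_bigr _ (fun p pP => congr1 (fun x : bool => x%:R) (condE p pP))).
rewrite (bigD1 a^-1%g) ?groupV //= eqxx big1 ?addr0 => [|p /andP[_ /negPf ->] //].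
by rewrite sn n3.
Qed.

(** Some [g0] carries the subgroup generated by [z], of order 3, to [P]. Then [k ^ g] lies in [N]
    exactly when [z ^ g] lies in [P], that is, when [g] lies in [g0 N]. *)
Lemma card_conj_in_N k : (3 %| #[k]%g)%N -> #|[set g | (k ^ g)%g \in N]| = #|N|.
Proof.
move=> k3; pose z := (k ^+ (#[k]%g %/ 3))%g.
have oz : #[z]%g = 3%N by rewrite orderXdiv ?dvdn_div // divnA // mulKn.
have pz : (3.-group <[z]>)%g by rewrite /pgroup -orderE oz.
have [g0 _ zP] := Sylow_Jsub sylP (subsetT _) pz.
have {zP}Pz : <[z ^ g0]>%g = P.
  by apply/eqP; rewrite eqEcard -!orderE orderJ oz oc andbT cycleJ.
rewrite -(card_lcoset N g0); apply: eq_card => g; rewrite inE mem_lcoset.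
have conjE x : (x ^ g = (x ^ g0) ^ (g0^-1 * g))%g by rewrite -conjgM mulKVg.
apply/idP/idP => [kN|gN].
  have zgP : (z ^ g)%g \in P.
    by apply: mem_sylow3_order3; rewrite ?orderJ // /z conjXg groupX.
  apply/normP; rewrite -{1}Pz -cycleJ -conjE.
  by apply/eqP; rewrite eqEcard cycle_subG zgP /= -!orderE orderJ oz oc.
have gNN : (g0^-1 * g)%g \in 'N(N)%g := subsetP (normG _) _ gN.
rewrite conjE (memJ_norm _ gNN); apply/normP; rewrite -Pz -cycleJ.
have zk : (z ^ k = z)%g by rewrite /z conjXg conjgE mulKg.
by rewrite -conjJg zk.
Qed.

(* Its sum over conjugates is #|N| times the value of the virtual character
   2 Ind_N 1 + Ind_N inv_sign - Ind_B 1, because #|N| = 3 #|B|. *)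
Definition local_weight n : int :=
  2 * (n \in N)%:R + inv_sign n *+ (n \in N) - 3 * (n \in B)%:R.

(** Averaging over [P] first replaces the weight by a multiple of the indicator of the 3-singular
    elements of [N], whose conjugates [card_conj_in_N] counts. *)
Lemma sum_local_weight k :
  \sum_g local_weight (k ^ g)%g = 3 * #|N|%:Z * (3 %| #[k]%g)%:R.
Proof.
apply: (@mulfI _ 3%:R) => //.
have -> : 3%:R * (\sum_g local_weight (k ^ g)%g) =
    \sum_g \sum_(p in P) local_weight ((k ^ g) ^ p)%g.
  rewrite exchange_big /= -[3%:R]/(3%N%:R) -oc orderE mulr_natl -sumr_const.
  apply: eq_bigr => p _; rewrite [LHS](reindex_inj (mulIg p)) /=.
  by apply: eq_bigr => g _; rewrite conjgM.
have inner n : \sum_(p in P) local_weight (n ^ p)%g =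
    9 * ((n \in N) && (3 %| #[n]%g)%N)%:R.
  have memN p : p \in P -> ((n ^ p)%g \in N) = (n \in N).
    by move=> pP; rewrite memJ_norm // (subsetP (normG _)) ?(subsetP sylow3_sub_norm).
  case: (boolP (n \in N)) => nN; last first.
    rewrite mulr0 big1 // => p pP; rewrite /local_weight memN // (negPf nN).
    rewrite (_ : (_ \in B) = false) //.
    by apply: contraNF nN => /(subsetP complement_sub_norm); rewrite memN.
  rewrite (eq_bigr (fun p => 2 + inv_sign n - 3 * ((n ^ p)%g \in B)%:R)) => [|p pP].
    rewrite sumrB sumr_const -mulr_sumr count_conj_in_B // -orderE oc.
    by case: (boolP (3 %| _)%N) => n3 /=; rewrite -mulr_natl; ring.
  by rewrite /local_weight memN // nN inv_sign_conj // mulr1.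
rewrite (eq_bigr _ (fun g _ => inner _)) -mulr_sumr.
rewrite (eq_bigr (fun g => (3 %| #[k]%g)%:R * ((k ^ g)%g \in N)%:R)) => [|g _].
  rewrite -mulr_sumr -natr_sum; case: (boolP (3 %| _)%N) => k3; last by rewrite mul0r !mulr0.
  rewrite -big_mkcond /= sum1dep_card card_conj_in_N // natz.
  ring.
by rewrite orderJ; case: (_ \in N); rewrite ?mulr0 ?mulr1 ?andbF.
Qed.

End Local.

(** * Units of order 3q *)

Lemma gr_coef_mul_sum_all (R : comNzRingType) (gT : finGroupType) (x : groupRing R gT) g :
  gr_coef (x * sum_twist R [set: gT] (fun=> 1)) g = augmentation x.
Proof.
rewrite gr_coef_mul; apply: eq_bigr => h _.
by rewrite gr_coef_twist inE !mulr1n mulr1.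
Qed.

Lemma augmentation_mod3 (gT : finGroupType) (x : groupRing int gT) :
  augmentation (gr_mod3 x) = (augmentation x)%:~R.
Proof. by rewrite /augmentation rmorph_sum; apply: eq_bigr => g _; rewrite gr_coef_mod3. Qed.

(** The rank identity holds for [F] and for [F * F]. By [coset_lattice_rank] and [#|N| = 3 #|B|] the
    sum weighted by [local_weight] vanishes, and this sum is [3 #|N|] times the one for [sing 3]. *)
Lemma lin_sing3_eq0 (gT : finGroupType) (F E : groupRing int gT) (q : nat) :
    (3 %| #|gT|)%N -> ~~ (9 %| #|gT|)%N -> ~~ (3 %| q)%N ->
    F * F * F + F * F *+ (3 * q) + F *+ (3 * q ^ 2) = 0 ->
    E * F = F *+ q -> F * E = F *+ q -> augmentation E = 0 ->
  lin (sing 3) (F * F + F *+ (3 * q)) = 0.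
Proof.
move=> d3 d9 q3 F3 EF FE E0; set z := F * F + _.
have [c [B [oc sylP PB tiPB]]] := sylow3_complement d3 d9.
set N := 'N(<[c]>)%G.
have isM := inv_signM oc; have is2 := inv_sign2 oc.
have b3 : ~~ (3 %| #|B|)%N by apply: three_ndvd_complement sylP PB tiPB.
have ranks F' : E * F' = F' *+ q -> F' * E = F' *+ q ->
    \rank (map_mx (intr : int -> 'F_3)
       (gr_lmx F' *m gr_rmx (sum_twist int B (fun=> 1)))) =
    (2 * \rank (map_mx (intr : int -> 'F_3)
       (gr_lmx F' *m gr_rmx (sum_twist int N (fun=> 1)))) +
     \rank (map_mx (intr : int -> 'F_3)
       (gr_lmx F' *m gr_rmx (sum_twist int N (inv_sign c)))))%N.
  move=> EF' FE'; rewrite !map_mxM map_lmx_mod3 !map_rmx_mod3.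
  rewrite -(sum_sylow3_mul_complement PB tiPB) -(sum_sylow3_mul_signed oc PB tiPB) !gr_mod3M.
  apply: (@rank_mod3_identity _ (gr_mod3 (gr_delta c - gr_delta c^-1%g)) _ _ _
    (gr_mod3 (sum_twist int [set: gT] (fun=> 1))) (gr_mod3 (double_coset_sum c)) #|B|
    b3 _ _ _ _ _ _ _ _ _ (gr_mod3 E) q q3); rewrite -?gr_mod3M.
  - by rewrite (sqr_diff oc) gr_mod3D gr_mod3N (gr_mod3Mn 1 3) (@gr_mulrn3 _ _ 3) // subr0.
  - by rewrite sum_sylow3_mul_diff gr_mod3_0.
  - by rewrite (sum_complement_mul_diff oc PB).
  - by rewrite (signed_sum_mul_diff oc PB).
  - by rewrite sqr_sum_complement gr_mod3Mn.
  - by rewrite (sqr_signed_sum oc PB) gr_mod3Mn.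
  - exact: mod3_ker_diff.
  - rewrite (sum_sylow3_mul_complement PB tiPB) (norm_double_coset_sum_norm oc sylP PB tiPB) gr_mod3Mn gr_mod3D gr_mod3N //.
  - by rewrite EF' gr_mod3Mn.
  - by rewrite FE' gr_mod3Mn.
  move=> x; apply: gr_coefP => g.
  rewrite gr_mod3_twist gr_coef_mul_sum_all augmentationM augmentation_mod3 E0.
  by rewrite mul0r gr_coef0.
have EFF : E * (F * F) = F * F *+ q by rewrite mulrA EF mulrnAl.
have FFE : F * F * E = F * F *+ q by rewrite -mulrA FE mulrnAr.
have r1 := ranks F EF FE; have r2 := ranks _ EFF FFE.
have one2 (H : {group gT}) : {in H &, forall g h : gT, 1 = 1 * 1 :> int}.
  by move=> g h _ _; rewrite mulr1.
have one1 (H : {group gT}) : {in H, forall g : gT, 1 * 1 = 1 :> int}.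
  by move=> g _; rewrite mulr1.
have lB := coset_lattice_rank (one2 B) (one1 B) q3 F3.
have lN := coset_lattice_rank (one2 N) (one1 N) q3 F3.
have lC := @coset_lattice_rank _ N _ isM is2 _ _ q3 F3.
have cN := card_norm_sylow3 oc PB tiPB.
have : lin (fun k => \sum_g local_weight c B (k^-1 ^ g)%g) z = 0.
  transitivity (2 * lin (fun k => \sum_g gr_coef (sum_twist int N (fun=> 1)) (k^-1 ^ g)%g) z
    + lin (fun k => \sum_g gr_coef (sum_twist int N (inv_sign c)) (k^-1 ^ g)%g) z
    - 3 * lin (fun k => \sum_g gr_coef (sum_twist int B (fun=> 1)) (k^-1 ^ g)%g) z).
    rewrite /lin !mulr_sumr -big_split -sumrB; apply: eq_bigr => k _ /=.
    rewrite !(mulrCA _ (gr_coef z k)) -mulrDr -mulrBr; congr (_ * _).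
    rewrite !mulr_sumr -big_split -sumrB; apply: eq_bigr => g _ /=.
    by rewrite /local_weight !gr_coef_twist !intz.
  by rewrite lB lN lC r1 r2 cN !PoszD ?PoszM; ring.
rewrite (eq_lin _ (fun k => sum_local_weight oc sylP PB tiPB k^-1%g)).
rewrite (@eq_lin _ _ (fun k => 3 * #|N|%:Z * sing 3 k)) => [|k]; last by rewrite orderV.
rewrite /lin; under eq_bigr => k _ do rewrite mulrCA.
rewrite -mulr_sumr => /eqP; rewrite mulf_eq0 => /orP[|/eqP//].
by rewrite mulf_eq0 /= eqz_nat => /eqP N0; have := cardG_gt0 N; rewrite N0.
Qed.

Lemma dvdn_order_expg (gT : finGroupType) (g : gT) m r : prime r -> coprime m r ->
  (r %| #[g ^+ m]%g)%N = (r %| #[g]%g)%N.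
Proof.
move=> r_pr cmr; apply/idP/idP => [h|h].
  by apply: dvdn_trans h _; rewrite order_dvdn -expgM mulnC expgM expg_order expg1n.
have : (r %| m * #[(g ^+ m)%g]%g)%N.
  by apply: dvdn_trans h _; rewrite order_dvdn expgM expg_order.
rewrite Euclid_dvdM // => /orP[rm|//].
by move: cmr; rewrite coprime_sym prime_coprime // rm.
Qed.

Lemma sing_expg (gT : finGroupType) (g : gT) m r : prime r -> coprime m r ->
  sing r (g ^+ m)%g = sing r g.
Proof. by move=> r_pr cmr; rewrite /sing dvdn_order_expg. Qed.

Lemma class_fun_sing (gT : finGroupType) r : class_fun (@sing gT r).
Proof. exact: (class_fun_order (fun k => (r %| k)%:R)). Qed.

(** No cube in the group is 3-singular, so [lin_pow_vanish] makes the sum for [u ^+ 3] divisible by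
    3; it would be 1 if [u ^+ 3] had order 3. *)
Lemma no_unit_order9 (gT : finGroupType) (u : groupRing int gT) :
  ~~ (9 %| #|gT|)%N -> augmentation u = 1 -> u ^+ 9 = 1 -> u ^+ 3 = 1.
Proof.
move=> d9 au u9; apply/eqP; apply: contraT => u3.
have s1 : lin (sing 3) (u ^+ 3) = 1.
  by apply: lin_sing_prime_order; rewrite -?exprM // augmentationX au expr1n.
have : ((3 ^ (2 - 1))%N %| lin (sing 3) (u ^+ (3 ^ 1)))%Z.
  apply: lin_pow_vanish => // [|g]; first exact: class_fun_sing.
  rewrite /sing expn1 (_ : (3 %| _)%N = false) //; apply: contraNF d9 => d3.
  rewrite -cardsT; apply: dvdn_trans (order_dvdG (in_setT g)).
  by rewrite (@orderXpfactor _ 3 1 _ _ (erefl _)) // (@dvdn_pmul2l 3 3).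
by rewrite expn1 s1.
Qed.

Lemma cube_shift (R : pzRingType) (a : R) :
  (a + 1) ^+ 3 = 1 -> a * a * a + a * a *+ 3 + a *+ 3 = 0.
Proof.
rewrite !exprS expr0 mulr1 !(mulrDl, mulrDr, mul1r, mulr1) => e.
apply: (addIr 1); rewrite add0r -[RHS]e !mulrSr mulr0n add0r.
rewrite !mulrA !addrA; do 3! congr (_ + _).
by rewrite addr0 [RHS]addrAC.
Qed.

Lemma sqr_shift (R : pzRingType) (a : R) :
  a * a + a *+ 3 = (a + 1) ^+ 2 + (a + 1) ^+ 1 - 2%:R.
Proof.
rewrite !exprS expr0 !mulr1 !(mulrDl, mulrDr, mul1r, mulr1).
apply: (addIr 2%:R); rewrite subrK !mulrSr mulr0n !add0r !addrA.
by congr (_ + 1); rewrite [RHS]addrAC.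
Qed.

Lemma no_unit_order3q (gT : finGroupType) (u : groupRing int gT) q :
    prime q -> q != 3%N -> ~~ (9 %| #|gT|)%N -> augmentation u = 1 ->
    u ^+ (3 * q) = 1 -> u ^+ 3 != 1 -> u ^+ q != 1 ->
  exists g : gT, (3 * q %| #[g]%g)%N.
Proof.
move=> q_pr q3 d9 au u3q u3 uq; apply/existsP; apply: contraT.
rewrite negb_exists => /forallP noG.
have q0 := prime_gt0 q_pr; have q1 := prime_gt1 q_pr.
have c3q : coprime 3 q by rewrite prime_coprime // dvdn_prime2 // eq_sym.
have cq3 : coprime q 3 by rewrite coprime_sym.
have n0 : (0 < 3 * q)%N by rewrite muln_gt0.
pose v := u ^+ q; pose w := u ^+ 3.
have v3 : v ^+ 3 = 1 by rewrite /v -exprM mulnC.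
have wq : w ^+ q = 1 by rewrite /w -exprM.
have augX i : augmentation (u ^+ i) = 1 by rewrite augmentationX au expr1n.
pose s := lin (@sing gT 3).
have s0 x n : coprime 3 n -> x ^+ n = 1 -> s x = 0.
  by move=> c3n xn; apply: (lin_sing_coprime _ c3n xn).
have sv : s v = 1 by apply: lin_sing_prime_order => //; apply: augX.
have sv2 : s (v ^+ 2) = 1.
  apply: lin_sing_prime_order => //.
  - by rewrite -(exprM v) mulnC exprM v3 expr1n.
  - apply: contra uq => /eqP v21.
    have uq3 : u ^+ q = v ^+ 3 by rewrite exprS v21 mulr1.
    by rewrite uq3 v3.
  - by rewrite /v -exprM augX.
have d3 : (3 %| #|gT|)%N.
  apply: contraT => nd3; have : s v = 0; last by rewrite sv.
  rewrite /s /lin big1 // => g _; rewrite /sing (_ : (3 %| _)%N = false) ?mulr0 //.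
  apply: contraNF nd3 => /dvdn_trans; apply.
  by rewrite -cardsT order_dvdG ?inE.
have sX j : coprime j (3 * q) -> s (u ^+ j) = s u.
  move=> cj; apply: (lin_coprime_pow _ u3q n0 cj); first exact: class_fun_sing.
  move=> p g p_pr pG; apply: sing_expg => //.
  by rewrite prime_coprime // dvdn_prime2 //; apply: contra pG => /eqP ->.
(* The sums of [u] for 3 and for [q] add up to 1; the sum for [q] is congruent modulo 3 to that of
   [w = u ^+ 3], which is 1. *)
have s3 : (3 %| s u)%Z.
  have su : s u + lin (sing q) u = 1.
    by apply: lin_sing_two_primes; rewrite // eq_sym.
  have sq1 : lin (sing q) w = 1.
    by apply: lin_sing_prime_order => //; apply: augX.
  have : (lin (sing q) w = lin (sing q) u %[mod 3])%Z.
    apply: lin_prime_pow => // [|g]; first exact: class_fun_sing.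
    by rewrite sing_expg.
  rewrite sq1 -su => /eqP; rewrite eqz_mod_dvd.
  by rewrite addrK.
pose M := norm_elt w q; pose E : groupRing int gT := q%:R - M.
(* [E / q] is an idempotent commuting with [v], so [F / q] satisfies the equation of [v - 1]
   obtained from [v ^+ 3 = 1]. *)
pose F := E * (v - 1).
have MM : M * M = M *+ q by apply: norm_eltM.
have EE : E * E = E *+ q.
  by rewrite /E mulrBl mulr_natl [M * _]mulrBr MM mulr_natr subrr subr0.
have Ev : E * v = v * E.
  rewrite /E mulrBr mulrBl mulr_natl mulr_natr /M /norm_elt mulr_suml mulr_sumr.
  by congr (_ - _); apply: eq_bigr => i _; rewrite -!exprM -!exprD addnC.
have Ev1 : E * (v - 1) = (v - 1) * E by rewrite [LHS]mulrBr [RHS]mulrBl Ev mulr1 mul1r.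
have EF : E * F = F *+ q by rewrite mulrA EE mulrnAl.
have FE : F * E = F *+ q by rewrite -mulrA -Ev1 mulrA EE mulrnAl.
have FF : F * F = E * ((v - 1) * (v - 1)) *+ q.
  by rewrite {2}/F mulrA FE mulrnAl -mulrA.
have FFF : F * F * F = E * ((v - 1) * (v - 1) * (v - 1)) *+ (q * q).
  rewrite -mulrA FF mulrnAr mulrA FE mulrnAl /F -!mulrA -mulrnA //.
have vid : (v - 1) * (v - 1) * (v - 1) + (v - 1) * (v - 1) *+ 3 + (v - 1) *+ 3 = 0.
  by apply: cube_shift; rewrite subrK.
have F3 : F * F * F + F * F *+ (3 * q) + F *+ (3 * q ^ 2) = 0.
  rewrite FFF FF /F -!mulrnA (_ : (q * (3 * q) = 3 * (q * q))%N); last by lia.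
  rewrite -(mulnn q) !(mulrnA _ 3) -!mulrnDl -!mulrnAr -!mulrDr.
  by rewrite mulrnAr vid mulr0 mul0rn.
have E0 : augmentation E = 0.
  rewrite augmentationE linB linMn lin_one -augmentationE.
  by rewrite augmentation_norm_elt ?augX // subrr.
have q3' : ~~ (3 %| q)%N by rewrite -prime_coprime.
have := lin_sing3_eq0 d3 d9 q3' F3 EF FE E0; rewrite -/s.
have -> : F * F + F *+ (3 * q) = E * (v ^+ 2 + v ^+ 1 - 2%:R) *+ q.
  have F3E : F *+ 3 = E * ((v - 1) *+ 3) by rewrite mulrnAr.
  rewrite FF mulrnA -mulrnDl F3E -mulrDr; congr (E * _ *+ q).
  by have := sqr_shift (v - 1); rewrite subrK.
rewrite /s linMn mulrDr mulrN mulrDr linB linD mulr_natr linMn -/s.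
have swv i k : (0 < i)%N -> (i < q)%N -> coprime k 3 -> s (w ^+ i * v ^+ k) = s u.
  move=> i0 iq ck; have -> : w ^+ i * v ^+ k = u ^+ (3 * i + q * k).
    by rewrite exprD !exprM.
  apply: sX; rewrite coprimeMr; apply/andP; split.
    rewrite coprime_sym [(3 * i)%N]mulnC /coprime gcdnMDl -/(coprime _ _).
    by rewrite coprimeMr c3q coprime_sym.
  rewrite coprime_sym addnC [(q * k)%N]mulnC /coprime gcdnMDl -/(coprime _ _).
  rewrite coprimeMr cq3 prime_coprime //.
  by apply/negP => /dvdn_leq; rewrite i0 => /(_ isT); rewrite leqNgt iq.
have sEv k : coprime k 3 -> s (v ^+ k) = 1 ->
    s (E * v ^+ k) = q%:R - (1 + s u *+ q.-1).
  move=> ck svk; rewrite /s mulrBl linB mulr_natl linMn; congr (_ - _).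
    by rewrite -/(s _) svk.
  rewrite /M /norm_elt mulr_suml lin_sum.
  rewrite (@sum_const_tail q (fun i => s (w ^+ i * v ^+ k)) (s u)) // => [|i i0 iq].
    by rewrite expr0 mul1r svk.
  exact: swv.
have sE : s E = 0.
  rewrite /s linB linMn lin_sum big1 ?subr0.
    by rewrite lin_one /sing order1 mul0rn.
  by move=> i _; apply: (s0 _ q) => //; rewrite -exprM mulnC exprM wq expr1n.
(* After cancelling [q] the equation reads [2 (q - 1) (1 - s u) = 0]. *)
rewrite !sEv // sE mul0rn subr0 => /eqP; rewrite mulrn_eq0 (gtn_eqF q0) /= => /eqP h.
have h1 : s u = 1.
  by move: h; rewrite -mulr_natr !natz; nia.
by rewrite h1 in s3.
Qed.

(* n.-primitive_root u : n is the least positive m such that u ^+ m = 1,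
   i.e. u has multiplicative order n. *)
Theorem theoremD (gT : finGroupType) (q : nat)
    (not9 : ~~ (9 %| #|gT|)%N) (q_prime : prime q) :
  (exists2 u : groupRing int gT,
     u \in normalized_units int gT & (3 * q)%N.-primitive_root u) <->
  (exists g : gT, #[g]%g = (3 * q)%N).
Proof.
have q0 := prime_gt0 q_prime; have q1 := prime_gt1 q_prime.
split=> [[u /andP[_ /eqP au] uprim]|[g og]].
  have u1 := prim_expr_order uprim.
  have uX k : (k < 3 * q)%N -> (0 < k)%N -> u ^+ k != 1.
    move=> kq k0; rewrite -(prim_order_dvd uprim).
    by apply/negP => /dvdn_leq; rewrite k0 leqNgt kq => /(_ isT).
  have u3 : u ^+ 3 != 1 by apply: uX; lia.
  have uq : u ^+ q != 1 by apply: uX; lia.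
  have [q3|q3] := eqVneq q 3%N.
    by rewrite q3 in u1; rewrite (no_unit_order9 not9 au u1) eqxx in u3.
  have [g qg] := no_unit_order3q q_prime q3 not9 au u1 u3 uq.
  exists (g ^+ (#[g]%g %/ (3 * q)))%g.
  by rewrite orderXdiv ?dvdn_div // divnA // mulKn.
(* Conversely, a group element of order [3 q] is itself such a unit. *)
exists (gr_delta g).
  rewrite inE; apply/andP; split.
    apply/unitrP; exists (gr_delta g^-1%g).
    by rewrite !gr_deltaM mulVg mulgV gr_delta1.
  by rewrite augmentationE lin_delta.
have deltaX k : gr_delta g ^+ k = gr_delta (g ^+ k)%g :> groupRing int gT.
  elim: k => [|k IH]; first by rewrite expr0 expg0 gr_delta1.
  by rewrite exprS expgS IH gr_deltaM.
have delta_inj h : (gr_delta h == 1 :> groupRing int gT) = (h == 1)%g.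
  apply/eqP/eqP => [|->]; last exact: gr_delta1.
  move/(congr1 (fun x => gr_coef x h)); rewrite gr_coef_delta gr_coef_one eqxx.
  by case: (h =P 1%g).
apply/andP; split; first by rewrite muln_gt0.
apply/forallP => i; apply/eqP; rewrite unity_rootE deltaX delta_inj -order_dvdn og.
apply/idP/eqP => [d|->//]; apply/eqP; rewrite eqn_leq ltn_ord /=.
by rewrite dvdn_leq.
Qed.
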